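(* Let $d\in\mathbb{N}$, $2<p\le\infty$, $1\le q\le\infty$ and $s>d/2$ (so that $s>d/p$). Let $\mathcal{U}$ be the closed unit ball of $\mathbb{B}_{pq}^s(\mathbb{R}^d)$, i.e. the set of bounded continuous functions $f:\mathbb{R}^d\to\mathbb{R}$ with $\|f\|_{s,p,q,\lambda}\le 1$. Let $\delta$ satisfy $0<\delta\le d/2-d/p$. Let $\varphi:\mathbb{R}^d\to\mathbb{R}$ be a Borel function such that $\varphi(x)\ge c$ for all $x\in\mathbb{R}^d$ and some constant $c>0$, and such that $\int_{\mathbb{R}^d}\varphi(x)\langle x\rangle^{-d-2\delta}\,d\lambda(x)=1$. Define the probability measure $\mathbb{P}$ by $d\mathbb{P}(x)=\varphi(x)\langle x\rangle^{-d-2\delta}d\lambda(x)$. Then $\mathcal{U}$ is not $\mathbb{P}$-pregaussian.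
   Context: $\lambda$ is Lebesgue measure on $\mathbb{R}^d$, $\|h\|_{r,\mu}=(\int|h|^r d\mu)^{1/r}$ (essential supremum if $r=\infty$), and $\langle x\rangle^\gamma=(1+\|x\|^2)^{\gamma/2}$ with $\|\cdot\|$ the Euclidean norm. Besov norm: fix a $C^\infty$ function $\varphi_0$ on $\mathbb{R}^d$ with $\varphi_0(x)=1$ for $\|x\|\le1$ and $\varphi_0(x)=0$ for $\|x\|\ge3/2$; put $\varphi_1(x)=\varphi_0(x/2)-\varphi_0(x)$ and $\varphi_k(x)=\varphi_1(2^{-k+1}x)$ for $k\ge1$. For a tempered distribution $T$ with Fourier transform $FT$, $\|T\|_{s,p,q,\lambda}=\big(\sum_{k\ge0}2^{ksq}\|F^{-1}(\varphi_k FT)\|_{p,\lambda}^q\big)^{1/q}$ (with $\sup_k 2^{ks}\|F^{-1}(\varphi_kFT)\|_{p,\lambda}$ if $q=\infty$). $B^s_{pq}(\mathbb{R}^d)$ is the space of real tempered distributions with finite norm; for $s>d/p$ every element has a unique bounded continuous representative, and $\mathbb{B}^s_{pq}(\mathbb{R}^d)$ denotes the space of these continuous representatives with the same norm. Pregaussian: for a probability measure $\mathbb{P}$ on $\mathbb{R}^d$ and $\mathcal{F}\subseteq\mathcal{L}^2(\mathbb{P})$, a Brownian bridge on $\mathcal{F}$ is a centered Gaussian process $\mathbb{G}$ indexed by $\mathcal{F}$ with covariance $E\mathbb{G}(f)\mathbb{G}(g)=\mathbb{P}[(f-\mathbb{P}f)(g-\mathbb{P}g)]$, inducing the semimetric $\rho(f,g)=(E[\mathbb{G}(f)-\mathbb{G}(g)]^2)^{1/2}$.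 $\mathcal{F}$ is $\mathbb{P}$-pregaussian if such a $\mathbb{G}$ can be defined so that every sample path $f\mapsto\mathbb{G}(f)$ is bounded and uniformly $\rho$-continuous on $\mathcal{F}$. *)

(* Defs.v *)
From HB Require Import structures.
From mathcomp Require Import all_boot all_order all_algebra.
From mathcomp Require Import all_classical all_reals all_analysis.
Set Implicit Arguments. Unset Strict Implicit. Unset Printing Implicit Defensive.
Import Order.TTheory GRing.Theory Num.Theory.
Import numFieldNormedType.Exports.
Local Open Scope classical_set_scope.
Local Open Scope ring_scope.

Section Defs.
Variable R : realType.

Definition edot (d : nat) (x y : 'rV[R]_d) : R := \sum_(i < d) x ord0 i * y ord0 i.
Definition enorm (d : nat) (x : 'rV[R]_d) : R := Num.sqrt (edot x x).

Definition japan (d : nat) (g : R) (x : 'rV[R]_d) : R :=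
  (1 + enorm x ^+ 2) `^ (g / 2).

Definition cons_rv (n : nat) (x : R) (v : 'rV[R]_n) : 'rV[R]_n.+1 :=
  \row_(i < n.+1) match unlift ord0 i with None => x | Some j => v ord0 j end.

(** Lebesgue integral on R^n of a nonnegative extended-real function, defined
    as the iterated one-dimensional Lebesgue integral (equal to the integral
    w.r.t. the n-dimensional Lebesgue measure by Tonelli). *)
Fixpoint intd (n : nat) : ('rV[R]_n -> \bar R) -> \bar R :=
  match n return ('rV[R]_n -> \bar R) -> \bar R with
  | 0 => fun g => g 0
  | n'.+1 => fun g =>
      (\int[@lebesgue_measure R]_x intd (fun v => g (cons_rv x v)))%E
  end.

Definition integ (n : nat) (f : 'rV[R]_n -> R) : R :=
  fine (intd (fun x => (Num.max (f x) 0)%:E)) -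
  fine (intd (fun x => (Num.max (- f x) 0)%:E)).

Definition esssupd (n : nat) (h : 'rV[R]_n -> R) : \bar R :=
  ereal_inf [set M : \bar R |
    intd (fun y => (\1_[set y | (M < (h y)%:E)%E] y)%:E) = 0%E].

Definition Lpnormd (n : nat) (p : \bar R) (h : 'rV[R]_n -> R) : \bar R :=
  match p with
  | +oo%E => esssupd (fun x => `|h x|)
  | r%:E => match intd (fun x => (`|h x| `^ r)%:E) with
            | v%:E => (v `^ r^-1)%:E
            | +oo%E => +oo%E
            | -oo%E => 0%E
            end
  | -oo%E => 0%E
  end.

Fixpoint smooth_along (d : nat) (f : 'rV[R]_d -> R) (vs : seq 'rV[R]_d) : Prop :=
  match vs with
  | [::] => continuous f
  | v :: vs' => continuous f /\ (forall x, derivable f x v) /\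
                smooth_along ('D_v f) vs'
  end.
Definition smooth (d : nat) (f : 'rV[R]_d -> R) : Prop :=
  forall vs, smooth_along f vs.

Definition besov_cutoff (d : nat) (phi0 : 'rV[R]_d -> R) : Prop :=
  smooth phi0 /\
  (forall x, enorm x <= 1 -> phi0 x = 1) /\
  (forall x, 3 / 2 <= enorm x -> phi0 x = 0).

Definition phi1 (d : nat) (phi0 : 'rV[R]_d -> R) (x : 'rV[R]_d) : R :=
  phi0 (2^-1 *: x) - phi0 x.
Definition phik (d : nat) (phi0 : 'rV[R]_d -> R) (k : nat) (x : 'rV[R]_d) : R :=
  if k is k'.+1 then phi1 phi0 (((2:R) ^- k') *: x) else phi0 x.

(** Inverse Fourier transform of phi_k, with the convention
    F g (xi) = int g(x) e^{-2 pi i x.xi} dx, F^{-1} g (x) = int g(xi) e^{2 pi i x.xi} dxi;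
    real and imaginary parts. *)
Definition psik_re (d : nat) (phi0 : 'rV[R]_d -> R) (k : nat) (z : 'rV[R]_d) : R :=
  integ (fun xi => phik phi0 k xi * cos (2 * pi * edot z xi)).
Definition psik_im (d : nat) (phi0 : 'rV[R]_d -> R) (k : nat) (z : 'rV[R]_d) : R :=
  integ (fun xi => phik phi0 k xi * sin (2 * pi * edot z xi)).

(** |F^{-1}(phi_k F f)|(x) for a bounded continuous f: F^{-1}(phi_k F f)
    = (F^{-1} phi_k) * f (convolution). *)
Definition besov_block (d : nat) (phi0 : 'rV[R]_d -> R) (k : nat)
    (f : 'rV[R]_d -> R) (x : 'rV[R]_d) : R :=
  Num.sqrt ((integ (fun y => f y * psik_re phi0 k (x - y))) ^+ 2 +
            (integ (fun y => f y * psik_im phi0 k (x - y))) ^+ 2).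

Definition besov_norm (d : nat) (phi0 : 'rV[R]_d -> R) (s : R) (p q : \bar R)
    (f : 'rV[R]_d -> R) : \bar R :=
  let N k := (((2:R) `^ (k%:R * s))%:E * Lpnormd p (besov_block phi0 k f))%E in
  match q with
  | +oo%E => ereal_sup (range N)
  | r%:E =>
      let S := (\sum_(0 <= k <oo) (match N k with
                                   | v%:E => (v `^ r)%:E
                                   | _ => +oo%E end))%E in
      match S with
      | v%:E => (v `^ r^-1)%:E
      | +oo%E => +oo%E
      | -oo%E => 0%E
      end
  | -oo%E => 0%E
  end.

Definition besov_unit_ball (d : nat) (phi0 : 'rV[R]_d -> R) (s : R) (p q : \bar R) :
    set ('rV[R]_d -> R) :=
  [set f | continuous f /\ (exists M : R, forall x, `|f x| <= M) /\
           (besov_norm phi0 s p q f <= 1)%E].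

(* Borel measurability on R^d (product Borel sigma-algebra on d-tuples) *)
Definition rv_of_tuple (d : nat) (t : d.-tuple R) : 'rV[R]_d := \row_i tnth t i.
Definition borel_fun (d : nat) (f : 'rV[R]_d -> R) : Prop :=
  measurable_fun [set: d.-tuple R] (f \o @rv_of_tuple d).

Definition gauss_law (v : R) (A : set R) : \bar R :=
  if v == 0 then \d_(0:R) A else normal_prob 0 (Num.sqrt v) A.

(** P-pregaussian, for the probability measure P given by its integral
    functional Pint (Pint h = int h dP). *)
Definition pregaussian (d : nat) (Pint : ('rV[R]_d -> R) -> R)
    (F : set ('rV[R]_d -> R)) : Prop :=
  let cov f g := Pint (fun x => (f x - Pint f) * (g x - Pint g)) in
  exists (d' : measure_display) (Omega : measurableType d')
         (Pr : probability Omega R) (G : ('rV[R]_d -> R) -> Omega -> R),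
    (* G is a Brownian bridge on F: a centered Gaussian process with
       covariance cov (every finite linear combination is centered normal
       with the prescribed variance) *)
    (forall f, F f -> measurable_fun [set: Omega] (G f)) /\
    (forall (n : nat) (fs : 'I_n -> 'rV[R]_d -> R) (a : 'I_n -> R),
        (forall i, F (fs i)) ->
        forall A : set R, measurable A ->
          Pr ((fun w => \sum_(i < n) a i * G (fs i) w) @^-1` A) =
          gauss_law (\sum_(i < n) \sum_(j < n) a i * a j * cov (fs i) (fs j)) A) /\
    (let rho f g := Num.sqrt (fine (\int[Pr]_w ((G f w - G g w) ^+ 2)%:E)%E) in
     forall w : Omega,
       (exists M : R, forall f, F f -> `|G f w| <= M) /\
       (forall e : R, 0 < e -> exists eta : R, 0 < eta /\
          forall f g, F f -> F g -> rho f g < eta -> `|G f w - G g w| < e)).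

Definition inv_ext (p : \bar R) : R :=
  match p with r%:E => r^-1 | _ => 0 end.

End Defs.

(* Main.v *)
(** Functions whose Fourier transform lives in the unit ball only see the first
    Littlewood-Paley block, so on them the Besov norm is an L^p norm: [s] and [q] play
    no role. Such functions are the translates [wave z] of a product of squared
    sine quotients; for lattice points [z] and coefficients [a] with [|a|_p <= 1] the
    combinations [sum_z a_z wave z] stay in a fixed multiple of the unit ball.
    By linearity of the bridge [G] and a pointwise choice of signs, bounded sample
    paths bound [sum_z a_z |G (wave z)|] almost surely by a finite random variable.
    But [wave z] oscillates by a fixed amount near [z], where the density is at least
    of order [|z|^(-d - 2 delta)], so [G (wave z)] has standard deviation at least of
    order [|z|^(-d/2 - delta) >= |z|^(-d + d/p)]. Taking [a_z = 2^(-m d/p) M^(-1/p)] on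
    the m-th of M dyadic shells gives [|a|_p <= 1], while the standard deviations
    weighted by [a] sum to order [M^(1 - 1/p)], which is unbounded. *)
Require Import Defs.
From HB Require Import structures.
From mathcomp Require Import all_boot all_order all_algebra.
From mathcomp Require Import all_classical all_reals all_analysis.
From mathcomp Require Import measurable_realfun ring lra.
Set Implicit Arguments. Unset Strict Implicit. Unset Printing Implicit Defensive.
Import Order.TTheory GRing.Theory Num.Theory.
Import numFieldNormedType.Exports.
Local Open Scope classical_set_scope.
Local Open Scope ring_scope.

(** * Lebesgue measure on row vectors *)

(** The endpoint [delta = d/2 - d/p] is what forces many shells. There, a single shell of 2^(m d)
    sites, with coefficients 2^(-m d/p) and deviations of order 2^(-m (d - d/p)), contributes only a
    constant whatever m is; divergence comes from spreading the l^p mass over M shells. This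
    requires an overlap bound for the waves that does not depend on M, and squared sine quotients
    provide it: their decay t^(-2) is summable over the lattice. They are also nonnegative, hence
    usable as weights in a Jensen inequality, and their Fourier transforms are explicit tents. Both
    [sincsq_hat] and [tent_hat] are computed directly, so Fubini moves the convolution with F^{-1}
    phi_k onto phi_k, which is constantly 1 or 0 on the support of the tents, and the tents
    transform back into the wave. A bridge [G] is linear only almost surely, with one null set for
    each identity; each M involves finitely many sign patterns, so these null sets can be united. *)

Section rv_measurable.
Context {R : realType} {n : nat}.
(** Transported from tuples, so that measurability on row vectors is the predicate [borel_fun] of
    the statement. *)
Let rv_measurable : set (set 'rV[R]_n) :=
  [set A | measurable (@rv_of_tuple R n @^-1` A)].

Let rv_measurable0 : rv_measurable set0.
Proof. by rewrite /rv_measurable /= preimage_set0. Qed.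

Let rv_measurableC A : rv_measurable A -> rv_measurable (~` A).
Proof. by rewrite /rv_measurable /= preimage_setC; exact: measurableC. Qed.

Let rv_measurable_bigcup (F : (set 'rV[R]_n)^nat) :
  (forall i, rv_measurable (F i)) -> rv_measurable (\bigcup_i F i).
Proof.
by rewrite /rv_measurable /= preimage_bigcup => mF; exact: bigcup_measurable.
Qed.

Definition rv_display : measure_display.
Proof. exact: (measure_tuple_display default_measure_display). Qed.

HB.instance Definition _ := @isMeasurable.Build rv_display
  'rV[R]_n rv_measurable rv_measurable0 rv_measurableC rv_measurable_bigcup.
End rv_measurable.

Section rv_facts.
Context {R : realType}.

Lemma measurable_rv_of_tuple n : measurable_fun [set: n.-tuple R] (@rv_of_tuple R n).
Proof. by move=> _ Y mY; rewrite setTI. Qed.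

Lemma borel_funE n (f : 'rV[R]_n -> R) :
  borel_fun f <-> measurable_fun [set: 'rV[R]_n] f.
Proof.
split=> mf _ Y mY.
  by rewrite setTI; have := mf measurableT Y mY; rewrite setTI.
by have := mf measurableT Y mY; rewrite !setTI.
Qed.

Lemma measurable_coord n (i : 'I_n) :
  measurable_fun [set: 'rV[R]_n] (fun x => x ord0 i).
Proof.
apply/borel_funE; rewrite /borel_fun (_ : _ \o _ = fun t : n.-tuple R => tnth t i).
  exact: measurable_tnth.
by apply/funext => t /=; rewrite mxE.
Qed.

Lemma measurable_fun_rv d (T : measurableType d) n (f : T -> 'rV[R]_n) :
  (forall i, measurable_fun [set: T] (fun x => f x ord0 i)) ->
  measurable_fun [set: T] f.
Proof.
move=> mf.
rewrite (_ : f = @rv_of_tuple R n \o (fun x => [tuple f x ord0 i | i < n])).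
  apply: measurableT_comp; first exact: measurable_rv_of_tuple.
  apply/measurable_fun_tnthP => i.
  rewrite (_ : _ \o _ = (fun x => f x ord0 i)) //.
  by apply/funext => x /=; rewrite tnth_mktuple.
by apply/funext => x; apply/rowP => i /=; rewrite mxE tnth_mktuple.
Qed.

Definition behead_rv n (v : 'rV[R]_n.+1) : 'rV[R]_n := \row_i v ord0 (lift ord0 i).
Lemma cons_rv0 n x (v : 'rV[R]_n) : cons_rv x v ord0 ord0 = x.
Proof. by rewrite mxE unlift_none. Qed.

Lemma cons_rvS n x (v : 'rV[R]_n) i : cons_rv x v ord0 (lift ord0 i) = v ord0 i.
Proof. by rewrite mxE liftK. Qed.

Lemma measurable_cons_rv n :
  measurable_fun [set: R * 'rV[R]_n] (fun p => cons_rv p.1 p.2).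
Proof.
apply: measurable_fun_rv => i; case: (unliftP ord0 i) => [j|] ->.
  under eq_fun do rewrite cons_rvS.
  apply: (@measurableT_comp _ _ _ _ _ _ (fun v : 'rV[R]_n => v ord0 j)) => //.
  exact: measurable_coord.
by under eq_fun do rewrite cons_rv0; exact: measurable_fst.
Qed.

Lemma cons_rvK n x (v : 'rV[R]_n) :
  (cons_rv x v ord0 ord0, behead_rv (cons_rv x v)) = (x, v).
Proof.
by rewrite cons_rv0; congr pair; apply/rowP => i; rewrite mxE cons_rvS.
Qed.

Lemma measurable_uncons_rv n :
  measurable_fun [set: 'rV[R]_n.+1] (fun v => (v ord0 ord0, behead_rv v)).
Proof.
apply: measurable_fun_pair; first exact: measurable_coord.
apply: measurable_fun_rv => i; under eq_fun do rewrite /= mxE.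
exact: measurable_coord.
Qed.
End rv_facts.

Section rv_lebesgue.
Context {R : realType}.
Local Open Scope ereal_scope.

Section cons_measure.
Variables (n : nat) (m : {sigma_finite_measure set 'rV[R]_n -> \bar R}).

Definition cons_measure : set 'rV[R]_n.+1 -> \bar R :=
  pushforward (@lebesgue_measure R \x m) (fun p => cons_rv p.1 p.2).

Let mcons : measurable_fun [set: measurableTypeR R * 'rV[R]_n]
  (fun p => cons_rv p.1 p.2) := @measurable_cons_rv R n.

Let cons_measure0 : cons_measure set0 = 0.
Proof. by rewrite /cons_measure /pushforward preimage_set0 measure0. Qed.

Let cons_measure_ge0 A : 0 <= cons_measure A.
Proof. exact: measure_ge0. Qed.

Let cons_measure_sigma_additive : semi_sigma_additive cons_measure.
Proof. exact: (@measure_semi_sigma_additive _ _ _ (pushforward _ (mfun_Sub (mem_set mcons)))). Qed.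

HB.instance Definition _ := isMeasure.Build _ _ _ cons_measure
  cons_measure0 cons_measure_ge0 cons_measure_sigma_additive.

Let cons_measure_sigma_finite : sigma_finite setT cons_measure.
Proof.
have /sigma_finiteP[F [TF ndF Foo]] := sigma_finiteT (@lebesgue_measure R).
have /sigma_finiteP[G [TG ndG Goo]] := sigma_finiteT m.
pose u := fun v : 'rV[R]_n.+1 => (v ord0 ord0, behead_rv v).
exists (fun k => u @^-1` (F k `*` G k)).
  rewrite predeqE => v; split => // _.
  have [i _ Fi] : (\bigcup_i F i) (v ord0 ord0) by rewrite -TF.
  have [j _ Gj] : (\bigcup_i G i) (behead_rv v) by rewrite -TG.
  exists (maxn i j) => //; split => /=.
    by move: Fi; exact/subsetPset/ndF/leq_maxl.
  by move: Gj; exact/subsetPset/ndG/leq_maxr.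
move=> k; have [mF Fk] := Foo k; have [mG Gk] := Goo k; split.
  rewrite -[X in measurable X]setTI; apply: measurable_uncons_rv => //.
  exact: measurableX.
rewrite /cons_measure /pushforward (_ : _ @^-1` _ = F k `*` G k).
  by rewrite product_measure1E// lte_mul_pinfty// ge0_fin_numE.
by apply/funext => -[x v]; have [xE vE] := cons_rvK x v; rewrite /preimage/= xE vE.
Qed.

HB.instance Definition _ := Measure_isSigmaFinite.Build _ _ _ cons_measure
  cons_measure_sigma_finite.

Lemma ge0_integral_cons_measure (f : 'rV[R]_n.+1 -> \bar R) :
  measurable_fun [set: 'rV[R]_n.+1] f -> (forall v, 0 <= f v) ->
  \int[cons_measure]_v f v =
  \int[@lebesgue_measure R]_x \int[m]_v f (cons_rv x v).
Proof.
move=> mf f0.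
rewrite ge0_integral_pushforward//= preimage_setT fubini_tonelli1//=.
exact: measurableT_comp.
Qed.

Lemma integral_cons_measure (f : 'rV[R]_n.+1 -> \bar R) :
  cons_measure.-integrable setT f ->
  \int[cons_measure]_v f v =
  \int[@lebesgue_measure R]_x \int[m]_v f (cons_rv x v).
Proof.
move=> fi; have mf := measurable_int _ fi.
have fi' : (@lebesgue_measure R \x m).-integrable setT
    (fun p => f (cons_rv p.1 p.2)).
  apply/integrableP; split; first exact: measurableT_comp.
  move/integrableP : fi => [_]; rewrite ge0_integral_pushforward//=.
  exact: measurableT_comp.
by rewrite integral_pushforward//= preimage_setT -integral12_prod_meas1.
Qed.
End cons_measure.

(* Built so that Tonelli turns its integral into the iterated integral [intd]. *)
Fixpoint leb n : {sigma_finite_measure set 'rV[R]_n -> \bar R} :=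
  match n with
  | 0 => [the {sigma_finite_measure set 'rV[R]_0 -> \bar R} of \d_(0%R : 'rV[R]_0)]
  | n'.+1 => [the {sigma_finite_measure set 'rV[R]_n'.+1 -> \bar R} of cons_measure (leb n')]
  end.

Lemma integral_leb0 (f : 'rV[R]_0 -> \bar R) : measurable_fun [set: 'rV[R]_0] f ->
  \int[leb 0]_v f v = f 0%R.
Proof. by move=> mf; rewrite integral_dirac// diracT mul1e. Qed.

Lemma ge0_integral_lebS n (f : 'rV[R]_n.+1 -> \bar R) :
  measurable_fun [set: 'rV[R]_n.+1] f -> (forall v, 0 <= f v) ->
  \int[leb n.+1]_v f v =
  \int[@lebesgue_measure R]_x \int[leb n]_v f (cons_rv x v).
Proof. exact: ge0_integral_cons_measure. Qed.

Lemma integral_lebS n (f : 'rV[R]_n.+1 -> \bar R) :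
  (leb n.+1).-integrable setT f ->
  \int[leb n.+1]_v f v =
  \int[@lebesgue_measure R]_x \int[leb n]_v f (cons_rv x v).
Proof. exact: integral_cons_measure. Qed.

Arguments leb : simpl never.

Lemma intdE n (f : 'rV[R]_n -> \bar R) : measurable_fun setT f ->
  (forall v, 0 <= f v) -> intd f = \int[leb n]_v f v.
Proof.
elim: n f => [|n IHn] f mf f0 /=; first by rewrite integral_leb0.
rewrite ge0_integral_lebS//; apply: eq_integral => x _.
rewrite IHn//; apply: measurableT_comp => //.
apply: (@measurableT_comp _ _ _ _ _ _ _ _ (fun v => (x, v)) (@measurable_cons_rv R n)).
exact: pair1_measurable.
Qed.

End rv_lebesgue.

(** Integrability makes both occurrences of [fine] in [integ] genuine values, so their difference is
    the integral. *)
Lemma integ_Rintegral (R : realType) n (f : 'rV[R]_n -> R) :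
  (leb n).-integrable setT (EFin \o f) ->
  integ f = \int[leb n]_v f v.
Proof.
move=> fi; have /measurable_EFinP mf := measurable_int _ fi.
rewrite /integ !intdE.
- rewrite /Rintegral [in RHS]integralE [RHS]fineB.
  + congr (fine _ - fine _); apply: eq_integral => v _.
      by rewrite funeposE /= EFin_max.
    by rewrite funenegE /= EFin_max.
  + by apply/integrable_fin_num => //; exact: integrable_funepos.
  + by apply/integrable_fin_num => //; exact: integrable_funeneg.
- by apply/measurable_EFinP; apply: measurable_maxr => //; exact: measurable_funN.
- by move=> v; rewrite lee_fin le_max lexx orbT.
- by apply/measurable_EFinP; exact: measurable_maxr.
- by move=> v; rewrite lee_fin le_max lexx orbT.
Qed.

(** * One-dimensional integrals *)

Section real_line.
Context {R : realType}.
Local Notation mu := (@lebesgue_measure R).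
Implicit Types (f u : R -> R) (a b c t th x z : R).

Lemma measurable_affine a b : measurable_fun [set: measurableTypeR R]
  (fun x : measurableTypeR R => a * x + b : measurableTypeR R).
Proof.
apply: measurable_funD; last exact: measurable_cst.
exact: measurable_funM.
Qed.

Definition affine_mfun a b : {mfun measurableTypeR R >-> measurableTypeR R} :=
  mfun_Sub (mem_set (measurable_affine a b)).

Section affine_image.
Variables a b : R.
Definition affine_image : set (measurableTypeR R) -> \bar R :=
  pushforward mu (affine_mfun a b).

Let affine_image0 : affine_image set0 = 0%E.
Proof. by rewrite /affine_image /pushforward preimage_set0 measure0. Qed.

Let affine_image_ge0 A : (0 <= affine_image A)%E.
Proof. exact: measure_ge0. Qed.

Let affine_image_sigma_additive : semi_sigma_additive affine_image.
Proof. exact: measure_semi_sigma_additive. Qed.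

HB.instance Definition _ := isMeasure.Build _ _ _ affine_image
  affine_image0 affine_image_ge0 affine_image_sigma_additive.
End affine_image.

(** The scaled image measure agrees with [mu] on half-open intervals, which determine Lebesgue
    measure. *)
Lemma lebesgue_measure_affine a b (A : set R) : 0 < a -> measurable A ->
  mu A = (a%:E * mu ((fun x => a * x + b)%R @^-1` A))%E.
Proof.
move=> a0 mA.
have -> : a%:E = ((NngNum (ltW a0))%:num)%:E by [].
pose m := affine_image a b.
rewrite -/(mscale (NngNum (ltW a0)) m A).
apply: lebesgue_measure_unique => //= _ [[p q] /= pq <-].
rewrite /mscale /= /m /affine_image /pushforward /=.
rewrite (_ : _ @^-1` _ = `]((p - b) / a), ((q - b) / a)]%classic); last first.
  apply/seteqP; split => x /=; rewrite !in_itv /= ltr_pdivrMr// ler_pdivlMr//;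
  by rewrite (mulrC x) ltrBlDr lerBrDr.
rewrite !lebesgue_measure_itv /= !lte_fin ltr_pM2r ?invr_gt0// ltrD2r.
case: ifP => _; rewrite ?mule0// -!EFinB -EFinM; congr EFin.
by field; rewrite gt_eqF.
Qed.

Lemma ge0_integral_affine a b (f : R -> \bar R) : 0 < a ->
  measurable_fun [set: R] f -> (forall x, 0 <= f x)%E ->
  (\int[mu]_x f x = a%:E * \int[mu]_x f (a * x + b)%R)%E.
Proof.
move=> a0 mf f0.
pose m := affine_image a b.
transitivity (\int[mscale (NngNum (ltW a0)) m]_x f x)%E.
  by apply: eq_measure_integral => A mA _; first [exact: lebesgue_measure_affine|exact/esym/lebesgue_measure_affine].
rewrite ge0_integral_mscale//; congr (_ * _)%E.
by rewrite ge0_integral_pushforward//.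
Qed.

Lemma measurable_EFin_affine a b (f : R -> \bar R) :
  measurable_fun [set: R] f -> measurable_fun [set: R] (fun x => f (a * x + b)).
Proof. by move=> mf; exact: (measurableT_comp mf (measurable_affine a b)). Qed.

Lemma integral_shift (f : R -> \bar R) z : measurable_fun [set: R] f ->
  (\int[mu]_x f (x - z)%R = \int[mu]_x f x)%E.
Proof.
move=> mf; rewrite integralE [in RHS]integralE; congr (_ - _)%E.
  rewrite [RHS](ge0_integral_affine (- z) ltr01 (measurable_funepos mf))// mul1e.
  by apply: eq_integral => x _; rewrite mul1r !funeposE.
rewrite [RHS](ge0_integral_affine (- z) ltr01 (measurable_funeneg mf))// mul1e.
by apply: eq_integral => x _; rewrite mul1r !funenegE.
Qed.

Lemma Rintegral_shift f z : measurable_fun [set: R] f ->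
  \int[mu]_x f (x - z) = \int[mu]_x f x.
Proof.
move=> mf; rewrite /Rintegral -[in RHS](@integral_shift (EFin \o f) z)//.
exact/measurable_EFinP.
Qed.

Lemma integrable_shift f z : mu.-integrable setT (EFin \o f) ->
  mu.-integrable setT (fun x => (f (x - z))%:E).
Proof.
move=> /integrableP[mf foo]; apply/integrableP; split.
  have := measurable_EFin_affine 1 (- z) mf.
  by under eq_fun do rewrite mul1r.
have mg : measurable_fun [set: R] (abse \o (EFin \o f)) by exact: measurableT_comp.
by have := integral_shift z mg => /= ->.
Qed.

Lemma ge0_integral_opp (g : R -> \bar R) : measurable_fun [set: R] g ->
  (forall x, 0 <= g x)%E -> (\int[mu]_x g (- x)%R = \int[mu]_x g x)%E.
Proof.
move=> mg g0.
rewrite -(@ge0_integral_pushforward _ _ _ _ _ (-%R : measurableTypeR R -> measurableTypeR R) _ mu setT g)//.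
by apply: eq_measure_integral => A mA _; rewrite -[RHS]lebesgue_measureN.
Qed.

Lemma Rintegral_odd f : mu.-integrable setT (EFin \o f) ->
  (forall x, f (- x) = - f x) -> \int[mu]_x f x = 0.
Proof.
move=> fi fN; have mf := measurable_int _ fi.
have : \int[mu]_x f (- x) = \int[mu]_x f x.
  rewrite /Rintegral integralE [in RHS]integralE; congr (fine (_ - _)%E).
    rewrite -[RHS](ge0_integral_opp (measurable_funepos mf))//.
    by apply: eq_integral => x _; rewrite !funeposE.
  rewrite -[RHS](ge0_integral_opp (measurable_funeneg mf))//.
  by apply: eq_integral => x _; rewrite !funenegE.
under eq_Rintegral do rewrite fN -mulN1r.
rewrite RintegralZl//; lra.
Qed.

Lemma integrableZl_EFin d (T : measurableType d)
    (m : {measure set T -> \bar R}) (f : T -> R) (k : R) :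
  m.-integrable setT (EFin \o f) -> m.-integrable setT (EFin \o (fun v => k * f v)).
Proof.
move=> fi; rewrite (_ : _ \o _ = (fun v => k%:E * (f v)%:E)%E).
  exact: integrableZl.
by apply/funext => v /=; rewrite EFinM.
Qed.

Lemma integrableD_EFin d (T : measurableType d)
    (m : {measure set T -> \bar R}) (f g : T -> R) :
  m.-integrable setT (EFin \o f) -> m.-integrable setT (EFin \o g) ->
  m.-integrable setT (EFin \o (fun v => f v + g v)).
Proof.
move=> fi gi; rewrite (_ : _ \o _ = (fun v => (f v)%:E + (g v)%:E)%E).
  exact: integrableD.
by apply/funext => v /=; rewrite EFinD.
Qed.

Lemma integrableB_EFin d (T : measurableType d)
    (m : {measure set T -> \bar R}) (f g : T -> R) :
  m.-integrable setT (EFin \o f) -> m.-integrable setT (EFin \o g) ->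
  m.-integrable setT (EFin \o (fun v => f v - g v)).
Proof.
move=> fi gi; rewrite (_ : _ \o _ = (fun v => (f v)%:E - (g v)%:E)%E).
  exact: integrableB.
by apply/funext => v /=; rewrite EFinB.
Qed.

Lemma integrable_mul_bounded d (T : measurableType d)
    (m : {measure set T -> \bar R}) (f g : T -> R) (M : R) :
  m.-integrable setT (EFin \o f) -> measurable_fun setT g ->
  (forall v, `|g v| <= M) -> m.-integrable setT (fun v => (f v * g v)%:E).
Proof.
move=> fi mg gM; have /measurable_EFinP mf := measurable_int _ fi.
apply: (@le_integrable _ _ _ m setT _ _ (fun v => (M * f v)%:E)) => //.
- by apply/measurable_EFinP; exact: measurable_funM.
- move=> v _ /=; rewrite lee_fin normrM [leRHS]normrM mulrC ler_wpM2r//.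
  by rewrite (le_trans (gM v))// ler_norm.
- exact: integrableZl_EFin.
Qed.

Lemma cos_bounded t : `|cos t| <= 1.
Proof. by rewrite ler_norml cos_geN1 cos_le1. Qed.

Lemma measurable_cos_affine th c : measurable_fun [set: R] (fun t : R => cos (th + c * t)).
Proof.
apply: continuous_measurable_fun => t.
apply: (@continuous_comp _ _ _ (fun t => th + c * t) cos); last exact: continuous_cos.
by apply: cvgD; [exact: cvg_cst|apply: cvgM => //; exact: cvg_cst].
Qed.

(** Shifting by [z] moves the translation into the phase; in the addition formula the sine term is
    odd and drops out. *)
Lemma even_integral_phase u th c z : mu.-integrable setT (EFin \o u) ->
  (forall x, u (- x) = u x) ->
  \int[mu]_t (u (t - z) * cos (th + c * t)) =
  cos (th + c * z) * \int[mu]_t (u t * cos (c * t)).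
Proof.
move=> ui uN.
have /measurable_EFinP mu_ := measurable_int _ ui.
rewrite -[LHS](@Rintegral_shift _ (- z)); last first.
  apply: measurable_funM; last exact: measurable_cos_affine.
  have /integrableP[/measurable_EFinP] := integrable_shift z ui.
  by [].
set th' := th + c * z.
have ic : mu.-integrable setT (fun t => (u t * cos (c * t))%:E).
  apply: (@integrable_mul_bounded _ _ mu u (fun t => cos (c * t)) 1) => //.
    by have := measurable_cos_affine 0 c; under eq_fun do rewrite add0r.
  by move=> x; exact: cos_bounded.
have is_ : mu.-integrable setT (fun t => (u t * sin (c * t))%:E).
  apply: (@integrable_mul_bounded _ _ mu u (fun t => sin (c * t)) 1) => //.
    apply: continuous_measurable_fun => t.
    apply: (@continuous_comp _ _ _ (fun t => c * t) sin); last exact: continuous_sin.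
    by apply: cvgM => //; exact: cvg_cst.
  by move=> x; rewrite ler_norml sin_geN1 sin_le1.
transitivity (\int[mu]_t (cos th' * (u t * cos (c * t)) - sin th' * (u t * sin (c * t)))).
  apply: eq_Rintegral => t _; rewrite opprK addrK.
  rewrite (_ : th + c * (t + z) = th' + c * t) ?cosD; last by rewrite /th'; ring.
  by ring.
rewrite RintegralB//; last 2 first.
- exact: integrableZl_EFin.
- exact: integrableZl_EFin.
rewrite !RintegralZl// (Rintegral_odd is_) ?mulr0 ?subr0// => x.
by rewrite uN mulrN sinN mulrN.
Qed.

(** The arctangent settles the half-line from 0, reflection the other one. This is the common
    majorant for [sincsq] and [tent]. *)
Lemma integrable_oneDsqrV : mu.-integrable setT (fun x => ((1 + x ^+ 2)^-1)%:E).
Proof.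
have mf : measurable_fun [set: R] (fun x : R => ((1 + x ^+ 2)^-1)%:E).
  apply/measurable_EFinP; apply: continuous_measurable_fun.
  exact: continuous_oneDsqrV.
have f0 x : (0 <= ((1 + x ^+ 2)^-1)%:E)%E.
  by rewrite lee_fin invr_ge0 addr_ge0// sqr_ge0.
apply/integrableP; split => //.
under eq_integral do rewrite gee0_abs//.
rewrite -(setUv `[0, +oo[%classic) ge0_integral_setU//=; last 3 first.
- exact: measurableC.
- by rewrite setUv.
- by apply/disj_setPS => x [].
have half : (\int[mu]_(x in `[0%R, +oo[) ((1 + x ^+ 2)^-1)%:E = (pi / 2)%:E)%E.
  exact: integral0y_oneDsqr.
rewrite half lte_add_pinfty ?ltry//.
apply: (@le_lt_trans _ _ (\int[mu]_(x in `]-oo, 0%R]) ((1 + x ^+ 2)^-1)%:E)%E).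
  apply: ge0_subset_integral => //.
  - exact: measurableC.
  - by apply: measurable_funS mf.
  - by move=> x /=; rewrite !in_itv /= andbT => /negP; rewrite -ltNge => /ltW.
have := ge0_integration_by_substitution0 mf f0; rewrite half.
by under [X in _ = X -> _]eq_integral do rewrite sqrrN; move=> <-; rewrite ltry.
Qed.

Lemma integrable_decay f C : measurable_fun [set: R] f ->
  (forall x, `|f x| <= C / (1 + x ^+ 2)) -> mu.-integrable setT (EFin \o f).
Proof.
move=> mf fC.
apply: (@le_integrable _ _ _ mu setT _ _ (fun x => (C * (1 + x ^+ 2)^-1)%:E)) => //.
- exact/measurable_EFinP.
- by move=> x _ /=; rewrite lee_fin (le_trans (fC x))// ler_norm.
- exact: (integrableZl_EFin _ integrable_oneDsqrV).
Qed.

Lemma normr_sin_le x : `|sin x| <= `|x|.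
Proof.
wlog x0 : x / 0 < x => [hw|].
  have [x0|x0|x0] := ltgtP x 0; [|exact: hw|by rewrite x0 sin0 normr0].
  by rewrite -normrN -sinN -[leRHS]normrN hw// oppr_gt0.
have [c _] := MVT x0 (fun y _ => is_derive_sin y)
  (continuous_subspaceT (@continuous_sin R)).
rewrite sin0 !subr0 => ->; rewrite normrM ler_piMl//.
by rewrite ler_norml cos_geN1 cos_le1.
Qed.

(* The value at [0] is the limit of [(sin (b t) / t)^2]. *)
Definition sincsq b t : R := if t == 0 then b ^+ 2 else (sin (b * t) / t) ^+ 2.

Lemma sincsq_ge0 b t : 0 <= sincsq b t.
Proof. by rewrite /sincsq; case: ifP; rewrite sqr_ge0. Qed.

Lemma sincsqN b t : sincsq b (- t) = sincsq b t.
Proof.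
by rewrite /sincsq oppr_eq0 mulrN sinN invrN mulrNN.
Qed.

Lemma sincsqNl b t : sincsq (- b) t = sincsq b t.
Proof. by rewrite /sincsq sqrrN mulNr sinN mulNr sqrrN. Qed.

Lemma sincsq0l t : sincsq 0 t = 0.
Proof. by rewrite /sincsq mul0r sin0 mul0r expr0n /= if_same. Qed.

Lemma sincsq_le b t : sincsq b t <= b ^+ 2.
Proof.
rewrite /sincsq; case: ifPn => // t0.
rewrite -ler_sqrt ?sqr_ge0// !sqrtr_sqr normrM normfV ler_pdivrMr ?normr_gt0//.
by rewrite -normrM normr_sin_le.
Qed.

(** Adds the two bounds [sincsq b t <= b ^+ 2] and [t ^+ 2 * sincsq b t <= 1]. *)
Lemma sincsq_decay b t : `|sincsq b t| <= (1 + b ^+ 2) / (1 + t ^+ 2).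
Proof.
rewrite ger0_norm ?sincsq_ge0// ler_pdivlMr ?ltr_pwDl ?sqr_ge0//.
rewrite mulrDr mulr1 addrC lerD ?sincsq_le// /sincsq; case: ifPn => [/eqP->|t0].
  by rewrite expr0n /= mulr0.
rewrite -exprMn divfK// -(cos2Dsin2 (b * t)) lerDr sqr_ge0//.
Qed.

Lemma continuous_sincsq b : continuous (sincsq b).
Proof.
have csin t : {for t, continuous (fun t => sin (b * t))}.
  apply: (@continuous_comp _ _ _ (fun t => b * t) sin); last exact: continuous_sin.
  by apply: cvgM => //; exact: cvg_cst.
move=> t; apply/continuous_withinNx.
have sE : \forall y \near t^', sincsq b y = (sin (b * y) / y) ^+ 2.
  have [->|t0] := eqVneq t 0.
    by near=> y; rewrite /sincsq ifN//; near: y; exact: nbhs_dnbhs_neq.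
  apply: nbhs_dnbhs.
  by near=> y; rewrite /sincsq ifN//; near: y; exact: open_neq.
suff : (sin (b * y) / y) ^+ 2 @[y --> t^'] --> sincsq b t.
  by apply: cvg_trans; apply: near_eq_cvg; apply: filterS sE => y ->.
have [t0|t0] := eqVneq t 0; last first.
  rewrite /sincsq ifN//; apply: cvg_within_filter.
  apply: (@cvgM _ _ _ _ (fun y => sin (b * y) / y) (fun y => sin (b * y) / y));
    by apply: cvgM; [exact: csin|exact: cvgV].
rewrite t0 /sincsq eqxx.
(* At 0, [sin (b * y) / y] is a difference quotient of [sin (b * t)], so its limit is the derivative
   [b]. *)
have D : is_derive (0 : R) 1 (sin \o (fun t => b * t)) (cos (b * 0) * b).
  apply: is_derive1_comp.
  by have := is_deriveZ b (is_derive_id (0 : R) 1); rewrite [b *: 1]mulr1.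
have : (fun h : R => h^-1 *: (((sin \o *%R b) \o shift 0) (h *: 1) - (sin \o *%R b) 0))
     @ 0^' --> 'D_1 (sin \o *%R b) 0 := @ex_derive _ _ _ _ _ _ _ D.
rewrite derive_val mulr0 cos0 mul1r => Db.
apply: (@cvgM _ _ _ _ (fun y => sin (b * y) / y) (fun y => sin (b * y) / y));
  (apply: cvg_trans Db; apply: near_eq_cvg; near=> y;
   by rewrite /= mulr0 sin0 subr0 addr0 [_ *: 1]mulr1 [LHS]mulrC).
Unshelve. all: by end_near.
Qed.

Lemma measurable_sincsq b : measurable_fun [set: R] (sincsq b).
Proof. by apply: continuous_measurable_fun; exact: continuous_sincsq. Qed.

Lemma integrable_sincsq b : mu.-integrable setT (EFin \o sincsq b).
Proof. by apply: (integrable_decay (measurable_sincsq b)); exact: sincsq_decay. Qed.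

(** Scaling: [sincsq a t = a ^+ 2 * sincsq 1 (a * t)] for [a > 0]. The mass of [sincsq 1] is carried
    along as a symbolic constant. *)
Lemma Rintegral_sincsq b :
  \int[mu]_t sincsq b t = `|b| * \int[mu]_t sincsq 1 t.
Proof.
have pos a : 0 < a -> \int[mu]_t sincsq a t = a * \int[mu]_t sincsq 1 t.
  move=> a0; rewrite /Rintegral -[X in X * _]/(fine a%:E) -fineM//; last first.
    exact: (integrable_fin_num measurableT (@integrable_sincsq 1)).
  congr fine; rewrite (@ge0_integral_affine a 0 (EFin \o sincsq 1))//; last 2 first.
  - by apply/measurable_EFinP; exact: measurable_sincsq.
  - by move=> x /=; rewrite lee_fin sincsq_ge0.
  rewrite muleA -EFinM -ge0_integralZl//; last 3 first.
  - by apply: measurable_EFin_affine; apply/measurable_EFinP; exact: measurable_sincsq.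
  - by move=> x _; rewrite lee_fin sincsq_ge0.
  - by rewrite lee_fin mulr_ge0// ltW.
  apply: eq_integral => x _; rewrite /= -EFinM addr0 /sincsq.
  have [->|x0] := eqVneq x 0; first by rewrite mulr0 eqxx expr1n mulr1 expr2.
  rewrite (negbTE (mulf_neq0 _ x0)) ?gt_eqF//.
  by congr EFin; rewrite !mul1r; field; rewrite x0 gt_eqF.
have [b0|b0|->] := ltgtP b 0.
- by rewrite ltr0_norm// -pos ?oppr_gt0//; apply: eq_Rintegral => t _; rewrite sincsqNl.
- by rewrite gtr0_norm// pos.
- by rewrite normr0 mul0r; under eq_Rintegral do rewrite sincsq0l; rewrite Rintegral_cst// mul0r.
Qed.

(* Product-to-sum: the Fourier transform of [sincsq b] becomes a combination of
   total masses of [sincsq], hence is known from scaling alone. *)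
Lemma sincsq_cos b B t : sincsq b t * cos (2 * B * t) =
  2^-1 * (sincsq (b + B) t + sincsq (b - B) t - 2 * sincsq B t).
Proof.
rewrite /sincsq; case: ifPn => [/eqP->|t0].
  by rewrite mulr0 cos0; field.
rewrite !expr_div_n !mulrA -!mulrDl -mulrBl [RHS]mulrA mulrAC; congr (_ / _).
have -> : 2 * B * t = (B * t) *+ 2 by rewrite mulr2n; ring.
rewrite cos_mulr2n mulrDl mulrBl sinD sinB !cos2sin2.
set x := sin (b * t); set y := sin (B * t); set z := cos (b * t); set w := cos (B * t).
have -> : (x * w + z * y) ^+ 2 + (x * w - z * y) ^+ 2 =
  2 * (x ^+ 2 * w ^+ 2 + z ^+ 2 * y ^+ 2) by ring.
rewrite [z ^+ 2]cos2sin2 [w ^+ 2]cos2sin2 -/x -/y.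
by field.
Qed.

(** Integrating [sincsq_cos] term by term leaves a second difference of the absolute value, which is
    a tent in [c]. *)
Lemma sincsq_hat b c : 0 < b ->
  \int[mu]_t (sincsq b t * cos (c * t)) =
  (\int[mu]_t sincsq 1 t) * Num.max (b - `|c| / 2) 0.
Proof.
move=> b0; pose B := c / 2; have -> : c = 2 * B by rewrite /B; field.
under eq_Rintegral do rewrite sincsq_cos.
have ii := integrable_sincsq.
have i2 : mu.-integrable setT (fun t => (2 * sincsq B t)%:E).
  exact: integrableZl_EFin (ii B).
have iD : mu.-integrable setT (fun t => (sincsq (b + B) t + sincsq (b - B) t)%:E).
  exact: integrableD_EFin (ii _) (ii _).
rewrite RintegralZl//; last first.
  exact: integrableB_EFin.
rewrite RintegralB// RintegralD//.
rewrite RintegralZl//.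
rewrite (Rintegral_sincsq (b + B)) (Rintegral_sincsq (b - B)) (Rintegral_sincsq B).
have -> : `|2 * B| / 2 = `|B| by rewrite normrM gtr0_norm//; field.
have E : `|b + B| + `|b - B| - 2 * `|B| = 2 * Num.max (b - `|B|) 0.
  rewrite maxEle; case: ifPn; rewrite -?ltNge;
    have [?|?] := ler0P (b + B); have [?|?] := ler0P (b - B);
    have [?|?] := ler0P B; lra.
set K := \int[mu]_t _; transitivity (2^-1 * K * (`|b + B| + `|b - B| - 2 * `|B|)).
  by ring.
by rewrite E; field.
Qed.
End real_line.

(** * The tent function and its Fourier transform *)

Section tent.
Context {R : realType}.
Local Notation mu := (@lebesgue_measure R).
Implicit Types (f u : R -> R) (a b c t th x z : R).

Lemma Rintegral_FTC f F (p q : R) : p < q -> continuous f ->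
  (forall x, is_derive x 1 F (f x)) -> \int[mu]_(x in `[p, q]) f x = F q - F p.
Proof.
move=> pq cf dF.
have cF : continuous F.
  by move=> x; apply: differentiable_continuous; apply/derivable1_diffP; exact: ex_derive.
rewrite /Rintegral (@continuous_FTC2 _ f F p q)//.
- exact: continuous_subspaceT.
- split.
  + by move=> x _; exact: ex_derive.
  + by apply: cvg_at_right_filter; exact: cF.
  + by apply: cvg_at_left_filter; exact: cF.
- by move=> x _; rewrite derive1E derive_val.
Qed.

(** The transform of [sincsq b] at frequency [x], up to its mass: for [c = 2 * pi * x] the term
    [|c| / 2] of [sincsq_hat] is [pi * |x|]. It vanishes for [|x| >= b / pi]. *)
Definition tent b x : R := Num.max (b - pi * `|x|) 0.

Lemma tent_ge0 b x : 0 <= tent b x.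
Proof. by rewrite le_max lexx orbT. Qed.

Lemma tentN b x : tent b (- x) = tent b x.
Proof. by rewrite /tent normrN. Qed.

Lemma tent_out b x : b / pi <= `|x| -> tent b x = 0.
Proof.
by rewrite ler_pdivrMr ?pi_gt0// mulrC => bx; apply/max_idPr; rewrite subr_le0.
Qed.

Lemma tent_in b x : `|x| <= b / pi -> tent b x = b - pi * `|x|.
Proof.
by rewrite ler_pdivlMr ?pi_gt0// mulrC => bx; apply/max_idPl; rewrite subr_ge0.
Qed.

Lemma continuous_tent b : continuous (tent b).
Proof.
move=> x; apply: (@continuous_max _ _ (fun x => b - pi * `|x|) (cst 0)).
  apply: cvgB; first exact: cvg_cst.
  by apply: cvgM; [exact: cvg_cst|exact: norm_continuous].
exact: cvg_cst.
Qed.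

Lemma measurable_tent b : measurable_fun [set: R] (tent b).
Proof. by apply: continuous_measurable_fun; exact: continuous_tent. Qed.

Lemma integrable_tent b : 0 < b -> mu.-integrable setT (EFin \o tent b).
Proof.
move=> b0; apply: (integrable_decay (C := b * (1 + (b / pi) ^+ 2))).
  exact: measurable_tent.
move=> x; rewrite ger0_norm ?tent_ge0// ler_pdivlMr ?ltr_pwDl ?sqr_ge0//.
have [bx|bx] := leP (b / pi) `|x|.
  by rewrite tent_out// mul0r mulr_ge0 ?addr_ge0 ?sqr_ge0// ltW.
rewrite tent_in ?(ltW bx)//; apply: ler_pM.
- by rewrite subr_ge0 mulrC -ler_pdivlMr ?pi_gt0// ltW.
- by rewrite addr_ge0 ?sqr_ge0.
- by rewrite gerBl mulr_ge0 ?pi_ge0.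
- rewrite lerD2l -[leLHS]real_normK ?num_real// ler_sqr ?nnegrE//; first exact: ltW.
  by rewrite divr_ge0 ?pi_ge0 ?(ltW b0).
Qed.

Lemma is_derive_sinM c x : is_derive x 1 (fun x => sin (c * x)) (c * cos (c * x)).
Proof.
have Dl := is_deriveZ c (is_derive_id x 1).
have := @is_derive1_comp _ sin ( *%R c) x _ _ (is_derive_sin (c * x)) Dl.
by rewrite [c *: 1]mulr1 mulrC.
Qed.

Lemma is_derive_cosM c x : is_derive x 1 (fun x => cos (c * x)) (- c * sin (c * x)).
Proof.
have Dl := is_deriveZ c (is_derive_id x 1).
have := @is_derive1_comp _ cos ( *%R c) x _ _ (is_derive_cos (c * x)) Dl.
by rewrite [c *: 1]mulr1 mulrC mulrN mulNr.
Qed.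

Lemma is_derive_affine a b x : is_derive x 1 (fun x => a + b * x) b.
Proof.
have := is_deriveD (is_derive_cst a x 1) (is_deriveZ b (is_derive_id x 1)).
by rewrite [b *: 1]mulr1 add0r.
Qed.

(** [F] is the primitive given by integration by parts. *)
Lemma Rintegral_affine_cos a b c (p q : R) : c != 0 -> p < q ->
  let F x := (a + b * x) * (c^-1 * sin (c * x)) + b / c ^+ 2 * cos (c * x) in
  \int[mu]_(x in `[p, q]) ((a + b * x) * cos (c * x)) = F q - F p.
Proof.
move=> c0 pq F; apply: (@Rintegral_FTC _ F) => //.
  move=> x; apply: cvgM.
    by apply: cvgD; [exact: cvg_cst|apply: cvgM => //; exact: cvg_cst].
  apply: (@continuous_comp _ _ _ (fun t => c * t) cos); last exact: continuous_cos.
  by apply: cvgM => //; exact: cvg_cst.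
move=> x.
have D1 := is_deriveM (is_derive_affine a b x) (is_deriveZ c^-1 (is_derive_sinM c x)).
have D2 := is_deriveZ (b / c ^+ 2) (is_derive_cosM c x).
have D : is_derive x 1 F ((a + b * x) * (c^-1 * (c * cos (c * x))) +
  c^-1 * sin (c * x) * b + b / c ^+ 2 * (- c * sin (c * x))) := is_deriveD D1 D2.
by apply: (is_derive_eq D); field.
Qed.

Lemma Rintegral_affine a b (p q : R) : p < q ->
  \int[mu]_(x in `[p, q]) (a + b * x) =
  (a * q + b * (q ^+ 2 / 2)) - (a * p + b * (p ^+ 2 / 2)).
Proof.
move=> pq; pose F x := a * x + b / 2 * (x * x).
transitivity (F q - F p); last by rewrite /F; field.
apply: Rintegral_FTC => //.
  by move=> x; apply: cvgD; [exact: cvg_cst|apply: cvgM => //; exact: cvg_cst].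
move=> x; have I := is_derive_id x (1 : R).
have D : is_derive x 1 F (a * 1 + b / 2 * (x * 1 + x * 1)) :=
  is_deriveD (is_deriveZ a I) (is_deriveZ (b / 2) (is_deriveM I I)).
by apply: (is_derive_eq D); field.
Qed.

Lemma tent_split b g : 0 < b -> continuous g ->
  \int[mu]_x (tent b x * g x) =
  \int[mu]_(x in `[- (b / pi), 0]) ((b + pi * x) * g x) +
  \int[mu]_(x in `[0, b / pi]) ((b - pi * x) * g x).
Proof.
move=> b0 cg; set B := b / pi; have B0 : 0 < B by rewrite divr_gt0 ?pi_gt0.
have ci (p q : R) : mu.-integrable `[p, q] (EFin \o (fun x => tent b x * g x)).
  apply: continuous_compact_integrable; first exact: segment_compact.
  by apply: continuous_subspaceT => x; apply: cvgM; [exact: continuous_tent|exact: cg].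
transitivity (\int[mu]_(x in `[- B, B]) (tent b x * g x)).
  rewrite [RHS]Rintegral_mkcond; apply: eq_Rintegral => x _.
  rewrite patchE; case: ifPn => //; rewrite notin_setE /= in_itv /= => /negP.
  by rewrite -ler_norml -ltNge => /ltW Bx; rewrite tent_out// mul0r.
have := @Rintegral_itvB _ (fun x => tent b x * g x) (BLeft (- B)) (BRight B) 0 (ci _ _).
rewrite !bnd_simp => /(_ (ltac:(by rewrite oppr_le0 ltW)) (ltW B0)) /eqP.
rewrite subr_eq => /eqP ->.
rewrite Rintegral_itv_obnd_cbnd; last first.
  by apply: (integrableS _ _ _ (ci 0 B)) => //; exact: subset_itv_oc_cc.
rewrite addrC; congr (_ + _); apply: eq_Rintegral => x; rewrite inE /= in_itv /= => /andP[x1 x2].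
  rewrite tent_in; first by rewrite ler0_norm// mulrN opprK.
  by rewrite ler0_norm// lerNl.
by rewrite tent_in ger0_norm.
Qed.

(** On each side of the kink the integrand is affine times cosine, and [1 - cos (2 u) = 2 sin^2 u]
    with [u = c * b / (2 * pi)] produces the squared quotient. Together with [sincsq_hat] this
    stands in for Fourier inversion. *)
Lemma tent_hat b c : 0 < b ->
  \int[mu]_x (tent b x * cos (c * x)) = 4 * pi * sincsq (b / (2 * pi)) c.
Proof.
move=> b0; have pi0 : pi != 0 :> R by rewrite gt_eqF ?pi_gt0.
have B0 : 0 < b / pi by rewrite divr_gt0 ?pi_gt0.
rewrite tent_split//; last first.
  move=> x.
  apply: (@continuous_comp _ _ _ (fun t => c * t) cos); last exact: continuous_cos.
  by apply: cvgM => //; exact: cvg_cst.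
under [X in _ + X]eq_Rintegral do rewrite -mulNr.
rewrite /=; have NB0 : - (b / pi) < 0 by rewrite oppr_lt0.
have [->|c0] := eqVneq c 0.
  rewrite /sincsq eqxx.
  under eq_Rintegral do rewrite mul0r cos0 mulr1.
  under [X in _ + X]eq_Rintegral do rewrite mul0r cos0 mulr1.
  by rewrite !Rintegral_affine//; set P := pi in pi0 B0 NB0 *; clearbody P; field.
rewrite (Rintegral_affine_cos _ _ c0 NB0) (Rintegral_affine_cos _ _ c0 B0) /sincsq (negbTE c0) !mulr0 cos0 sin0 !mulrN sinN cosN.
have -> : b / (2 * pi) * c = c * (b / (2 * pi)) by rewrite mulrC.
have -> : c * (b / pi) = c * (b / (2 * pi)) *+ 2 
  by rewrite mulr2n; move: pi0; generalize (pi : R) => P P0; field.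
rewrite cos_mulr2n cos2sin2.
by move: pi0; generalize (pi : R) => P P0; field; rewrite P0 c0.
Qed.
End tent.

(** * Oscillating integrals of product functions *)

Section product_integrals.
Context {R : realType}.
Local Notation mu := (@lebesgue_measure R).

Lemma EFin_Rintegral d (T : measurableType d) (m : {measure set T -> \bar R})
    (f : T -> R) : m.-integrable setT (EFin \o f) ->
  (\int[m]_x (f x)%:E = (\int[m]_x f x)%:E)%E.
Proof. by move=> fi; rewrite /Rintegral fineK//; exact: integrable_fin_num. Qed.

Lemma measurable_prod_coord n (u : 'I_n -> R -> R) :
  (forall i, measurable_fun [set: R] (u i)) ->
  measurable_fun [set: 'rV[R]_n] (fun v => \prod_i u i (v ord0 i)).
Proof.
move=> mu_; apply: measurable_prod => i _.
by apply: measurableT_comp => //; exact: measurable_coord.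
Qed.

Lemma integrable_prod_coord n (u : 'I_n -> R -> R) :
  (forall i, mu.-integrable setT (EFin \o u i)) ->
  (leb n).-integrable setT (fun v => (\prod_i u i (v ord0 i))%:E).
Proof.
move=> ui.
have mui m (w : 'I_m -> R -> R) : (forall i, mu.-integrable setT (EFin \o w i)) ->
    measurable_fun [set: 'rV[R]_m] (fun v => (\prod_i w i (v ord0 i))%:E).
  move=> wi; apply/measurable_EFinP; apply: measurable_prod_coord => i.
  by have /measurable_EFinP := measurable_int _ (wi i).
elim: n u ui => [|n IHn] u ui; apply/integrableP; split; try exact: mui.
  rewrite integral_leb0; last exact: measurableT_comp (@abse_measurable _ _) (mui 0%N u ui).
  by rewrite ltry.
rewrite ge0_integral_lebS//; last exact: measurableT_comp (@abse_measurable _ _) (mui _ u ui).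
pose w i := u (lift ord0 i).
have wi := IHn w (fun i => ui _).
(* Mass of the remaining coordinates; integrating them out leaves [C * |u ord0 x|]. *)
pose C := \int[leb n]_v `|\prod_i w i (v ord0 i)|.
have wai : (leb n).-integrable setT (EFin \o (fun v => `|\prod_i w i (v ord0 i)|)).
  by have := integrable_abse wi.
rewrite (_ : (fun x => _) = (fun x => (C * `|u ord0 x|)%:E)).
  have /integrableP[_] : mu.-integrable setT (EFin \o (fun x => C * `|u ord0 x|)).
    by apply: integrableZl_EFin; have := integrable_abse (ui ord0).
  apply: le_lt_trans; apply: ge0_le_integral => //.
  - by move=> x _; rewrite lee_fin mulr_ge0// Rintegral_ge0.
  - apply/measurable_EFinP; apply: measurable_funM => //.
    by apply: measurableT_comp => //; have /measurable_EFinP := measurable_int _ (ui ord0).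
  - apply: measurableT_comp => //; apply/measurable_EFinP; apply: measurable_funM => //.
    by apply: measurableT_comp => //; have /measurable_EFinP := measurable_int _ (ui ord0).
  - by move=> x _; rewrite lee_abs.
apply/funext => x; rewrite mulrC EFinM -EFin_Rintegral// -ge0_integralZl//; last first.
  by have /measurable_EFinP/measurable_EFinP := measurable_int _ wai.
apply: eq_integral => v _; rewrite big_ord_recl cons_rv0 -EFinM -normrM.
by under [in RHS]eq_bigr do rewrite /w -(cons_rvS x v).
Qed.

(* Carrying an arbitrary phase [th] lets the induction on the dimension treat real and
   imaginary parts at once, without complex exponentials. *)
Lemma integral_prod_phase n (u : 'I_n -> R -> R) (c tau w : 'I_n -> R) :
  (forall i, mu.-integrable setT (EFin \o u i)) ->
  (forall i th, \int[mu]_t (u i t * cos (th + c i * t)) = cos (th + tau i) * w i) ->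
  forall th,
  \int[leb n]_v ((\prod_i u i (v ord0 i)) * cos (th + \sum_i c i * v ord0 i)) =
  cos (th + \sum_i tau i) * \prod_i w i.
Proof.
have ib m (y : 'I_m -> R -> R) (e : 'I_m -> R) th :
    (forall i, mu.-integrable setT (EFin \o y i)) ->
    (leb m).-integrable setT (EFin \o (fun v : 'rV[R]_m =>
      (\prod_i y i (v ord0 i)) * cos (th + \sum_i e i * v ord0 i))).
  move=> yi; apply: (@integrable_mul_bounded _ _ _ (leb m)
    (fun v : 'rV[R]_m => \prod_i y i (v ord0 i)) (fun v => cos (th + \sum_i e i * v ord0 i)) 1).
  - exact: integrable_prod_coord.
  - apply: measurableT_comp.
      by apply: continuous_measurable_fun; exact: continuous_cos.
    apply: measurable_funD => //; apply: measurable_sum => i.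
    by apply: measurable_funM => //; exact: measurable_coord.
  - by move=> v; rewrite ler_norml cos_geN1 cos_le1.
elim: n u c tau w => [|n IHn] u c tau w ui uE th.
  have := measurable_int _ (ib 0%N u c th ui); rewrite /Rintegral => mF.
  by rewrite integral_leb0//= !big_ord0 addr0 mul1r mulr1.
rewrite {1}/Rintegral (integral_lebS (ib _ u c th ui)).
pose P := \prod_i w (lift ord0 i); pose S := \sum_i tau (lift ord0 i).
transitivity (\int[mu]_t (P * (u ord0 t * cos ((th + S) + c ord0 * t)))); last first.
  rewrite RintegralZl//; last first.
    apply: (@integrable_mul_bounded _ _ _ mu (u ord0)
      (fun t => cos (th + S + c ord0 * t)) 1) => //.
      exact: measurable_cos_affine.
    by move=> t; exact: cos_bounded.
  rewrite uE [\sum_i tau i]big_ord_recl [\prod_i w i]big_ord_recl /= -/P -/S.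
  by rewrite -(addrA th S) (addrC S); ring.
congr fine; apply: eq_integral => t _.
(* Once the first coordinate [t] is fixed, it only changes the phase of the remaining integral. *)
pose G (v : 'rV[R]_n) := (\prod_i u (lift ord0 i) (v ord0 i)) *
  cos (th + c ord0 * t + \sum_i c (lift ord0 i) * v ord0 i).
have Gi : (leb n).-integrable setT (EFin \o G) 
  by apply: (ib n (fun i => u (lift ord0 i)) (fun i => c (lift ord0 i)) (th + c ord0 * t)).
transitivity (\int[leb n]_v (u ord0 t * G v)%:E)%E.
  apply: eq_integral => v _; rewrite /= /G !big_ord_recl cons_rv0.
  congr EFin; rewrite -mulrA addrA; congr (_ * (_ * cos (_ + _))).
    by apply: eq_bigr => i _; rewrite cons_rvS.
  by apply: eq_bigr => i _; rewrite cons_rvS.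
rewrite EFin_Rintegral; last exact: integrableZl_EFin.
have := IHn (fun i => u (lift ord0 i)) (fun i => c (lift ord0 i))
  (fun i => tau (lift ord0 i)) (fun i => w (lift ord0 i)) (fun i => ui _)
  (fun i => uE _) (th + c ord0 * t).
rewrite RintegralZl// -/P -/S => ->; congr EFin.
by rewrite addrAC; ring.
Qed.
End product_integrals.

(** * Measurability and integrability of continuous functions *)

Section continuous_rv.
Context {R : realType}.

Lemma measurable_rv_ball n (x : 'rV[R]_n) (e : R) : measurable (ball x e).
Proof.
have [e0|e0] := ltP 0 e; last first.
  rewrite (_ : ball x e = set0)//; apply/seteqP; split => // y [e1 _].
  by move: e0; rewrite leNgt e1.
have mb (y e' : R) : measurable (ball y e').
  by apply: open_measurable; exact: ball_open.
(* Balls of row vectors are sup-norm balls, hence finite intersections of coordinate strips. *)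
rewrite (_ : ball x e = \bigcap_(i in [set: 'I_n])
    ((fun y : 'rV[R]_n => y ord0 i) @^-1` (ball (x ord0 i) e))).
  apply: fin_bigcap_measurable => // i _; rewrite -[X in measurable X]setTI.
  exact: measurable_coord.
apply/seteqP; split => y; first by move=> [_ xy] i _ /=; exact: xy.
by move=> xy; split => // i j; rewrite ord1; exact: xy.
Qed.

(** Links the topology to the transported sigma-algebra: an open set is a countable union of balls
    with rational centre and radius [k.+1%:R^-1]. *)
Lemma continuous_rv_measurable n (f : 'rV[R]_n -> R) : continuous f ->
  measurable_fun [set: 'rV[R]_n] f.
Proof.
move=> cf; apply: (measurability _ (RGenOpens.measurableE R)).
move=> _ [_ [a [b ->] <-]]; rewrite setTI.
have oU : open (f @^-1` `]a, b[%classic) by apply: open_comp => // x _; exact: cf.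
set U := f @^-1` _ in oU *.
pose B (p : 'rV[rat]_n * nat) : set 'rV[R]_n :=
  ball (\row_i (ratr (p.1 ord0 i) : R)) (p.2.+1%:R^-1).
rewrite (_ : U = \bigcup_p (if `[< B p `<=` U >] then B p else set0)).
  apply: countable_bigcupT_measurable; first exact: countableP.
  by move=> p; case: ifP => _; [exact: measurable_rv_ball|exact: measurable0].
apply/seteqP; split => x; last first.
  by move=> [p _]; case: ifPn => // /asboolP; exact.
move=> Ux; have /nbhs_ballP[e /= e0 eU] : nbhs x U by exact: open_nbhs_nbhs.
(* Half of [e], because a ball containing [x] reaches at most twice its radius away from [x]. *)
have [k ke] : exists k : nat, (k.+1%:R^-1 : R) < e / 2.
  have e20 : 0 < e / 2 by rewrite divr_gt0.
  have [k _ /(_ k (leqnn k)) ke] := near_infty_natSinv_lt (PosNum e20).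
  by exists k.
have /choice[q qx] : forall i : 'I_n, exists q : rat, `|ratr q - x ord0 i| < k.+1%:R^-1.
  move=> i; have [|q] := @rat_in_itvoo _ (x ord0 i - k.+1%:R^-1) (x ord0 i + k.+1%:R^-1).
    by rewrite ltrD2l gtrN ?invr_gt0.
  by rewrite in_itv /= -ltr_distl; exists q.
have k0 : 0 < (k.+1%:R^-1 : R) by rewrite invr_gt0.
have Bx : B (\row_i q i, k) x.
  by split => // i j; rewrite !mxE ord1; exact: qx.
exists (\row_i q i, k) => //; rewrite ifT//; apply/asboolP => y By.
apply: eU; apply: (@le_ball _ _ x (k.+1%:R^-1 + k.+1%:R^-1)).
  by rewrite (splitr e) lerD// ltW.
by apply: ball_triangle By; exact: ball_sym.
Qed.

Lemma normr_le_enorm n (x : 'rV[R]_n) i : `|x ord0 i| <= enorm x.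
Proof.
rewrite /enorm -sqrtr_sqr ler_sqrt; last by apply: sumr_ge0 => j _; rewrite -expr2 sqr_ge0.
rewrite /edot (bigD1 i)//= -expr2 lerDl; apply: sumr_ge0 => j _.
by rewrite -expr2 sqr_ge0.
Qed.

Lemma enormZ n (a : R) (x : 'rV[R]_n) : enorm (a *: x) = `|a| * enorm x.
Proof.
rewrite /enorm (_ : edot _ _ = a ^+ 2 * edot x x).
  by rewrite sqrtrM ?sqr_ge0// sqrtr_sqr.
by rewrite /edot mulr_sumr; apply: eq_bigr => i _; rewrite !mxE; ring.
Qed.

(** A compact cube contains the Euclidean support, and a multiple of its indicator dominates [f];
    that indicator is a product over the coordinates. *)
Lemma integrable_continuous_supp n (f : 'rV[R]_n -> R) (r : R) :
  continuous f -> (forall x, r <= enorm x -> f x = 0) ->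
  (leb n).-integrable setT (EFin \o f).
Proof.
move=> cf f0.
pose A := [set x : 'rV[R]_n | forall i, `[- r, r]%classic (x ord0 i)].
have cA : compact A.
  exact: (@rV_compact R n (fun=> `[- r, r]%classic) (fun i => @segment_compact R (- r) r)).
have [M [_ MA]] := compact_bounded (continuous_compact (continuous_subspaceT cf) cA).
have fM x : A x -> `|f x| <= M + 1 by move=> Ax; apply: MA; [rewrite ltrDl|exists x].
pose u (i : 'I_n) := \1_(`[- r, r]) : R -> R.
have ui i : (@lebesgue_measure R).-integrable setT (EFin \o u i).
  exact: integrable_indic_itv.
apply: (@le_integrable _ _ _ (leb n) setT _ _ (EFin \o (fun x => (M + 1) * \prod_i u i (x ord0 i)))) => //.
- by apply/measurable_EFinP; exact: continuous_rv_measurable.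
- move=> x _ /=; rewrite lee_fin.
  have [Ax|nAx] := pselect (A x).
    rewrite big1 ?mulr1; last by move=> i _; rewrite /u indicE mem_set//; exact: Ax.
    by rewrite (le_trans (fM x Ax))// ler_norm.
  rewrite f0 ?normr0//.
  have /existsNP[i] := nAx; rewrite /= in_itv /= -ler_norml => /negP.
  by rewrite -ltNge => /ltW /le_trans; apply; exact: normr_le_enorm.
- by apply: integrableZl_EFin; exact: integrable_prod_coord.
Qed.
End continuous_rv.

(** * Fubini for bounded kernels *)

Section fubini.
Context {R : realType} {n : nat}.
Variable F : 'rV[R]_n -> 'rV[R]_n -> R.
Variables h g : 'rV[R]_n -> R.
Hypotheses (hi : (leb n).-integrable setT (EFin \o h)).
Hypotheses (gi : (leb n).-integrable setT (EFin \o g)).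
Hypotheses (mF : measurable_fun [set: 'rV[R]_n * 'rV[R]_n] (fun p => F p.1 p.2)).
Hypotheses (F1 : forall x y, `|F x y| <= 1).

Let G (p : 'rV[R]_n * 'rV[R]_n) := h p.1 * (g p.2 * F p.1 p.2).

Let mF1 x : measurable_fun setT (F x).
Proof. exact: measurableT_comp mF (pair1_measurable x). Qed.

Let mF2 y : measurable_fun setT (F ^~ y).
Proof. exact: measurableT_comp mF (pair2_measurable y). Qed.

Let gF x : (leb n).-integrable setT (EFin \o (fun y => g y * F x y)).
Proof. exact: integrable_mul_bounded. Qed.

Let hF y : (leb n).-integrable setT (EFin \o (fun x => h x * F x y)).
Proof. exact: (@integrable_mul_bounded _ _ _ _ h (F ^~ y)). Qed.

Let Gi : (leb n \x leb n)%E.-integrable setT (EFin \o G).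
Proof.
have mh : measurable_fun [set: 'rV[R]_n] h by have /measurable_EFinP := measurable_int _ hi.
have mg : measurable_fun [set: 'rV[R]_n] g by have /measurable_EFinP := measurable_int _ gi.
have mG : measurable_fun [set: 'rV[R]_n * 'rV[R]_n] (EFin \o G).
  apply/measurable_EFinP; apply: measurable_funM; first exact: measurableT_comp.
  by apply: measurable_funM => //; exact: measurableT_comp.
apply: (@integrable12ltyP _ _ _ _ _ (leb n) (leb n) _ mG).2.
pose C := \int[leb n]_y `|g y|.
have gai : (leb n).-integrable setT (EFin \o (fun y => `|g y|)).
  by have := integrable_abse gi.
have /integrableP[_] : (leb n).-integrable setT (EFin \o (fun x => C * `|h x|)).
  by apply: integrableZl_EFin; have := integrable_abse hi.
apply: le_lt_trans; apply: ge0_le_integral => //.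
- by move=> x _; exact: integral_ge0.
- apply: (@measurable_fun_fubini_tonelli_F _ _ _ _ _ (leb n) (fun p => `|(G p)%:E|%E)) => //.
  exact: measurableT_comp.
- apply/measurable_EFinP; apply: measurableT_comp => //; apply: measurable_funM => //.
  exact: measurableT_comp.
move=> x _; apply: (@le_trans _ _ (\int[leb n]_y (`|h x| * `|g y|)%:E)%E).
  apply: ge0_le_integral => //.
  - by apply: measurableT_comp => //; exact: measurableT_comp mG (pair1_measurable x).
  - by apply/measurable_EFinP; apply: measurable_funM => //; exact: measurableT_comp.
  - move=> y _ /=; rewrite lee_fin !normrM ler_wpM2l// ler_piMr//.
rewrite EFin_Rintegral; last exact: integrableZl_EFin.
by rewrite RintegralZl// lee_fin -/C mulrC ler_norm.
Qed.

Lemma integrable_convolution :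
  (leb n).-integrable setT (EFin \o (fun x => h x * \int[leb n]_y (g y * F x y))).
Proof.
have := integrable_fubini_F Gi; apply: eq_integrable => // x _.
by rewrite /fubini_F /= /G /= EFin_Rintegral ?RintegralZl//; exact: integrableZl_EFin.
Qed.

(** With [h] a wave, [g] a cutoff and [F] the oscillating kernel, the wave gets integrated first,
    and its transform is explicit. *)
Lemma Rintegral_convolution :
  \int[leb n]_x (h x * \int[leb n]_y (g y * F x y)) =
  \int[leb n]_y (g y * \int[leb n]_x (h x * F x y)).
Proof.
have := Fubini Gi; rewrite {3 4}/Rintegral /= => E.
congr fine.
transitivity (\int[leb n]_x \int[leb n]_y (G (x, y))%:E)%E.
  apply: eq_integral => x _; rewrite /G /=.
  by rewrite EFin_Rintegral ?RintegralZl//; exact: integrableZl_EFin.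
rewrite [LHS]E; apply: eq_integral => y _; rewrite /G /=.
transitivity (\int[leb n]_x (g y * (h x * F x y))%:E)%E.
  by apply: eq_integral => x _; congr EFin; ring.
by rewrite EFin_Rintegral ?RintegralZl//; exact: integrableZl_EFin.
Qed.
End fubini.

(** * Littlewood-Paley blocks of band-limited functions *)

Section finite_sums.
Context {R : realType} d (T : measurableType d) (m : {measure set T -> \bar R}).

Lemma integrable_sum_EFin (I : Type) (r : seq I) (f : I -> T -> R) :
  (forall i, m.-integrable setT (EFin \o f i)) ->
  m.-integrable setT (EFin \o (fun v => \sum_(i <- r) f i v)).
Proof.
move=> fi; elim: r => [|i r IHr].
  by under eq_fun do rewrite big_nil; exact: integrable0.
by under eq_fun do rewrite big_cons; exact: integrableD_EFin.
Qed.

Lemma Rintegral_sum (I : Type) (r : seq I) (f : I -> T -> R) :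
  (forall i, m.-integrable setT (EFin \o f i)) ->
  \int[m]_v \sum_(i <- r) f i v = \sum_(i <- r) \int[m]_v f i v.
Proof.
move=> fi; elim: r => [|i r IHr].
  under eq_Rintegral do rewrite big_nil.
  by rewrite big_nil /Rintegral integral0.
under eq_Rintegral do rewrite big_cons.
by rewrite RintegralD ?IHr ?big_cons//; exact: integrable_sum_EFin.
Qed.
End finite_sums.

Section edot.
Context {R : realType} {n : nat}.
Implicit Types x y z : 'rV[R]_n.

Lemma edotBl x y z : edot (x - y) z = edot x z - edot y z.
Proof.
by rewrite /edot -sumrB; apply: eq_bigr => i _; rewrite !mxE mulrBl.
Qed.

Lemma continuous_coord (i : 'I_n) : continuous (fun x : 'rV[R]_n => x ord0 i).
Proof. exact: coord_continuous. Qed.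

Lemma continuous_scale (a : R) : continuous (fun x : 'rV[R]_n => a *: x).
Proof. exact: scaler_continuous. Qed.
End edot.

Section waves.
Context {R : realType} {d : nat}.
Local Notation mu := (@lebesgue_measure R).
Implicit Types x y z xi : 'rV[R]_d.

(** Makes [b / pi = d%:R^-1]: with [2 * pi] in the exponent of the Fourier transform, each factor of
    a wave has its spectrum in [[-1/d, 1/d]]. *)
Definition bandwidth : R := pi / d%:R.
Local Notation b := bandwidth.

Definition wave z x : R := \prod_(i < d) sincsq b (x ord0 i - z ord0 i).

Lemma wave_ge0 z x : 0 <= wave z x.
Proof. by apply: prodr_ge0 => i _; exact: sincsq_ge0. Qed.

Lemma wave_le z x : wave z x <= (b ^+ 2) ^+ d.
Proof.
rewrite /wave -[X in _ ^+ X]card_ord -prodr_const; apply: ler_prod => i _.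
by rewrite sincsq_ge0 sincsq_le.
Qed.

Lemma wave_center z : wave z z = (b ^+ 2) ^+ d.
Proof.
rewrite /wave -[X in _ ^+ X]card_ord -prodr_const; apply: eq_bigr => i _.
by rewrite subrr /sincsq eqxx.
Qed.

Lemma wave_shift z x y : wave (z + y) (x + y) = wave z x.
Proof. by apply: eq_bigr => i _; rewrite !mxE; congr sincsq; ring. Qed.

Lemma continuous_wave z : continuous (wave z).
Proof.
rewrite /wave; move: (index_enum _) => r.
elim: r => [|i r IHr].
  by under [X in continuous X]eq_fun do rewrite big_nil; exact: cst_continuous.
under [X in continuous X]eq_fun do rewrite big_cons.
have ci : continuous (fun x => sincsq b (x ord0 i - z ord0 i)).
  move=> x; apply: (@continuous_comp _ _ _ (fun x : 'rV[R]_d => x ord0 i - z ord0 i) (sincsq b)).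
    exact: cvgB (@continuous_coord _ _ i x) (@cvg_cst _ _ _ _ _).
  exact: continuous_sincsq.
by move=> x; exact: cvgM (ci x) (IHr x).
Qed.

Lemma integrable_wave z : (leb d).-integrable setT (EFin \o wave z).
Proof.
apply: (@integrable_prod_coord _ _ (fun i t => sincsq b (t - z ord0 i))) => i.
exact/integrable_shift/integrable_sincsq.
Qed.

(* The inverse Fourier transform of [g], rotated by the phase [th]: its real part is
   [osc 0 g] and its imaginary part [osc (- (pi / 2)) g]. *)
Definition osc (th : R) (g : 'rV[R]_d -> R) z : R :=
  \int[leb d]_xi (g xi * cos (th + 2 * pi * edot z xi)).

Definition sinc_mass : R := \int[mu]_t sincsq 1 t.

Hypothesis d0 : (0 < d)%N.

Lemma bandwidth_gt0 : 0 < b.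
Proof. by rewrite divr_gt0 ?pi_gt0 ?ltr0n. Qed.

(** Coordinatewise [sincsq_hat] at frequency [2 * pi * xi_i]; evenness sends the centre [z] into the
    phase. *)
Lemma wave_hat z xi th x :
  \int[leb d]_y (wave z y * cos (th + 2 * pi * edot (x - y) xi)) =
  cos (th + 2 * pi * edot (x - z) xi) *
  \prod_(i < d) (sinc_mass * tent b (xi ord0 i)).
Proof.
pose c (i : 'I_d) := - (2 * pi * xi ord0 i).
have E y th' : th' + 2 * pi * edot (x - y) xi =
    (th' + 2 * pi * edot x xi) + \sum_i c i * y ord0 i.
  rewrite edotBl mulrBr addrA; congr (_ + _); rewrite /edot mulr_sumr -sumrN.
  by apply: eq_bigr => i _; rewrite /c; ring.
under eq_Rintegral do rewrite E.
rewrite E; apply: (integral_prod_phase (u := fun i t => sincsq b (t - z ord0 i))).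
  by move=> i; exact/integrable_shift/integrable_sincsq.
move=> i th'; rewrite even_integral_phase; last 2 first.
- exact: integrable_sincsq.
- by move=> t; rewrite sincsqN.
congr (_ * _); rewrite sincsq_hat ?bandwidth_gt0//.
rewrite /c normrN normrM /tent; congr (_ * Num.max (_ - _) _).
by rewrite ger0_norm ?mulr_ge0 ?pi_ge0//; field.
Qed.

Lemma measurable_edot (f g : 'rV[R]_d * 'rV[R]_d -> 'rV[R]_d) :
  measurable_fun setT f -> measurable_fun setT g ->
  measurable_fun setT (fun p => edot (f p) (g p)).
Proof.
move=> mf mg; apply: measurable_sum => i; apply: measurable_funM.
  exact: (measurableT_comp (measurable_coord i)).
exact: (measurableT_comp (measurable_coord i)).
Qed.

Lemma measurable_osc_kernel th x :
  measurable_fun [set: 'rV[R]_d * 'rV[R]_d]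
    (fun p => cos (th + 2 * pi * edot (x - p.1) p.2)).
Proof.
apply: measurableT_comp.
  by apply: continuous_measurable_fun; exact: continuous_cos.
apply: measurable_funD => //; apply: measurable_funM => //.
apply: measurable_edot => //; apply: measurable_fun_rv => i.
under eq_fun do rewrite !mxE; apply: measurable_funB => //.
exact: (measurableT_comp (measurable_coord i)).
Qed.

Lemma measurable_osc_phase th z :
  measurable_fun [set: 'rV[R]_d] (fun xi => cos (th + 2 * pi * edot z xi)).
Proof.
apply: measurableT_comp.
  by apply: continuous_measurable_fun; exact: continuous_cos.
apply: measurable_funD => //; apply: measurable_funM => //.
apply: measurable_sum => i; apply: measurable_funM => //.
exact: measurable_coord.
Qed.

Section convolution.
Variable g : 'rV[R]_d -> R.
Hypothesis gi : (leb d).-integrable setT (EFin \o g).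

Lemma integrable_wave_osc z th x :
  (leb d).-integrable setT (EFin \o (fun y => wave z y * osc th g (x - y))).
Proof.
apply: (integrable_convolution (integrable_wave z) gi (measurable_osc_kernel th x)).
by move=> *; exact: cos_bounded.
Qed.

Lemma wave_osc z th x :
  \int[leb d]_y (wave z y * osc th g (x - y)) =
  \int[leb d]_xi (g xi * (cos (th + 2 * pi * edot (x - z) xi) *
    \prod_(i < d) (sinc_mass * tent b (xi ord0 i)))).
Proof.
rewrite (Rintegral_convolution (integrable_wave z) gi (measurable_osc_kernel th x)).
  by apply: eq_Rintegral => xi _; rewrite wave_hat.
by move=> *; exact: cos_bounded.
Qed.

(* The cube |xi_i| < 1/d, off which the tents vanish, lies in the unit ball. *)
Lemma prod_tent_out xi : 1 < enorm xi ->
  \prod_(i < d) (sinc_mass * tent b (xi ord0 i)) = 0.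
Proof.
move=> xi1; have [/existsP[i xii]|/existsPn xii] :=
    boolP [exists i : 'I_d, (d%:R^-1 <= `|xi ord0 i|)].
  rewrite (bigD1 i)//= tent_out ?mulr0 ?mul0r//.
  by rewrite /b mulrAC divff ?mul1r// gt_eqF ?pi_gt0.
suff : enorm xi <= 1 by rewrite leNgt xi1.
rewrite /enorm -[leRHS]sqrtr1 ler_sqrt//.
apply: (@le_trans _ _ (\sum_(i < d) (d%:R^-1 : R))); last first.
  by rewrite sumr_const card_ord -[leLHS]mulr_natr mulVf// pnatr_eq0 -lt0n.
apply: ler_sum => i _; rewrite -expr2 -real_normK ?num_real//.
have /ltW xii' : `|xi ord0 i| < d%:R^-1 by rewrite ltNge xii.
rewrite (le_trans (y := `|xi ord0 i| * 1))//; last by rewrite mulr1.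
rewrite expr2 ler_wpM2l// (le_trans xii')// invf_le1 ?ltr0n//.
by rewrite ler1n.
Qed.

(** Disjoint supports: [g] vanishes on the unit ball, the tents outside it. *)
Lemma wave_osc_high z th x : (forall xi, enorm xi <= 1 -> g xi = 0) ->
  \int[leb d]_y (wave z y * osc th g (x - y)) = 0.
Proof.
move=> g0; rewrite wave_osc.
under eq_Rintegral.
  move=> xi _; rewrite (_ : _ * _ = 0); first by over.
  by have [/g0->|/prod_tent_out->] := leP (enorm xi) 1; rewrite ?mul0r// !mulr0.
by rewrite /Rintegral integral0.
Qed.

(** On the support of the tents [g] is 1, and [tent_hat] at [2 * pi * (x_i - z_i)] returns
    [sincsq b (x_i - z_i) / pi] in each coordinate. *)
Lemma wave_osc_low z th x : (forall xi, enorm xi <= 1 -> g xi = 1) ->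
  \int[leb d]_y (wave z y * osc th g (x - y)) =
  cos th * ((sinc_mass / pi) ^+ d * wave z x).
Proof.
move=> g1; rewrite wave_osc.
pose c (i : 'I_d) := 2 * pi * (x ord0 i - z ord0 i).
transitivity (\int[leb d]_xi ((\prod_(i < d) (sinc_mass * tent b (xi ord0 i))) *
    cos (th + \sum_i c i * xi ord0 i))).
  apply: eq_Rintegral => xi _; have -> : 2 * pi * edot (x - z) xi = \sum_i c i * xi ord0 i.
    by rewrite /edot mulr_sumr; apply: eq_bigr => i _; rewrite /c !mxE; ring.
  by have [/g1->|/prod_tent_out->] := leP (enorm xi) 1; rewrite ?mul1r 1?mulrC// !(mulr0, mul0r).
have ti : mu.-integrable setT (EFin \o (fun t => sinc_mass * tent b t)).
  by apply: integrableZl_EFin; apply: integrable_tent; exact: bandwidth_gt0.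
rewrite (integral_prod_phase (u := fun=> (fun t => sinc_mass * tent b t))
  (tau := fun=> 0) (w := fun i => sinc_mass / pi * sincsq b (x ord0 i - z ord0 i))); last 2 first.
- by [].
- move=> i th'; have := @even_integral_phase _ _ th' (c i) 0 ti.
  rewrite mulr0 => H; rewrite -[RHS](_ : cos (th' + 0) * \int[mu]_t (sinc_mass * tent b t * cos (c i * t)) = _).
    by rewrite -H; [apply: eq_Rintegral => t _; rewrite subr0|move=> t; rewrite tentN].
  congr (_ * _); under eq_Rintegral do rewrite -mulrA.
  rewrite RintegralZl//; last first.
    apply: (@integrable_mul_bounded _ _ _ mu (tent b) (fun t => cos (c i * t)) 1).
    - by apply: integrable_tent; exact: bandwidth_gt0.
    - by have := measurable_cos_affine 0 (c i); under eq_fun do rewrite add0r.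
    - by move=> *; exact: cos_bounded.
  rewrite tent_hat ?bandwidth_gt0// /sincsq /c.
  have pi0 : pi != 0 :> R by rewrite gt_eqF ?pi_gt0.
  rewrite !mulf_eq0 pnatr_eq0 (negbTE pi0) /=; case: ifPn => t0.
    by move: pi0; generalize (pi : R) => P P0; field.
  rewrite (_ : b / (2 * pi) * _ = b * (x ord0 i - z ord0 i)).
    by move: pi0; generalize (pi : R) => P P0; field; rewrite t0.
  by move: pi0; generalize (pi : R) => P P0; field.
rewrite big1 ?addr0//; congr (_ * _).
by rewrite big_split /= prodr_const card_ord.
Qed.
End convolution.

Section blocks.
Variable phi0 : 'rV[R]_d -> R.
Hypothesis cut : besov_cutoff phi0.

Let cphi : continuous phi0. Proof. by case: cut => /(_ [::]). Qed.

Lemma continuous_phik k : continuous (phik phi0 k).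
Proof.
have cz a : continuous (fun x => phi0 (a *: x)).
  move=> x; apply: (@continuous_comp _ _ _ (fun x => a *: x) phi0); last exact: cphi.
  exact: continuous_scale.
case: k => [|k]; first exact: cphi.
have c2 : continuous (fun x => phi0 (2^-1 *: (2 ^- k *: x))).
  move=> x; apply: (@continuous_comp _ _ _ (fun x => 2 ^- k *: x) (fun x => phi0 (2^-1 *: x))).
    exact: continuous_scale.
  exact: cz.
by move=> x; exact: cvgB (c2 x) (cz _ x).
Qed.

Lemma integrable_phik k : (leb d).-integrable setT (EFin \o phik phi0 k).
Proof.
have [_ [_ out]] := cut.
(* [phik phi0 k] vanishes beyond radius 3/2 for [k = 0] and beyond [3 * 2^(k-1)] for [k >= 1];
   [2^k * 2] exceeds both. *)
apply: (@integrable_continuous_supp _ _ _ (2 ^+ k * 2)); first exact: continuous_phik.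
move=> x; case: k => [|k] xk.
  by apply: out; rewrite expr0 mul1r in xk; lra.
have k2 : 0 < (2 ^+ k : R) by rewrite exprn_gt0.
have xk2 : 4 <= enorm (2 ^- k *: x).
  rewrite enormZ ger0_norm ?invr_ge0 ?(ltW k2)// ler_pdivlMl//.
  by move: xk; rewrite exprS; lra.
rewrite /phik /phi1 !out ?subrr//; first by lra.
by rewrite enormZ ger0_norm; lra.
Qed.

Lemma phik0_in x : enorm x <= 1 -> phik phi0 0 x = 1.
Proof. by case: cut => _ [one _]; exact: one. Qed.

(** At points of the unit ball both terms of the difference defining [phi1] equal 1, at every scale
    [2 ^- k]. *)
Lemma phikS_in k x : enorm x <= 1 -> phik phi0 k.+1 x = 0.
Proof.
case: cut => _ [one _] x1; have xk : enorm (2 ^- k *: x) <= 1.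
  rewrite enormZ ger0_norm ?invr_ge0 ?exprn_ge0// ler_pdivrMl ?exprn_gt0// mulr1.
  by rewrite (le_trans x1)// exprn_ege1// ler1n.
have x0 : 0 <= enorm (2 ^- k *: x) by exact: sqrtr_ge0.
rewrite /phik /phi1 !one ?subrr//.
by rewrite enormZ ger0_norm//; lra.
Qed.

Lemma psik_reE k : psik_re phi0 k = osc 0 (phik phi0 k).
Proof.
apply/funext => z; rewrite /psik_re /osc integ_Rintegral.
  by apply: eq_Rintegral => xi _; rewrite add0r.
apply: (@integrable_mul_bounded _ _ _ (leb d) _ (fun xi => cos (2 * pi * edot z xi)) 1).
- exact: integrable_phik.
- by have := measurable_osc_phase 0 z; under eq_fun do rewrite add0r.
- by move=> xi; exact: cos_bounded.
Qed.

Lemma psik_imE k : psik_im phi0 k = osc (- (pi / 2)) (phik phi0 k).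
Proof.
have E (t : R) : sin t = cos (- (pi / 2) + t).
  by rewrite cosD cosN sinN cos_pihalf sin_pihalf mul0r add0r mulN1r opprK.
apply/funext => z; rewrite /psik_im /osc integ_Rintegral.
  by apply: eq_Rintegral => xi _; rewrite E.
under [X in EFin \o X]eq_fun do rewrite E.
apply: (@integrable_mul_bounded _ _ _ (leb d) _ (fun xi => cos (- (pi / 2) + 2 * pi * edot z xi)) 1).
- exact: integrable_phik.
- exact: measurable_osc_phase.
- by move=> xi; exact: cos_bounded.
Qed.

Section combination.
Variables (I : finType) (a : I -> R) (z : I -> 'rV[R]_d).

Definition waves x := \sum_i a i * wave (z i) x.

Lemma integ_waves_osc th k x :
  integ (fun y => waves y * osc th (phik phi0 k) (x - y)) =
  \sum_i a i * \int[leb d]_y (wave (z i) y * osc th (phik phi0 k) (x - y)).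
Proof.
have E y : waves y * osc th (phik phi0 k) (x - y) =
    \sum_i a i * (wave (z i) y * osc th (phik phi0 k) (x - y)).
  by rewrite /waves mulr_suml; apply: eq_bigr => i _; rewrite mulrA.
have ii i := integrable_wave_osc (integrable_phik k) (z i) th x.
rewrite (_ : (fun y => _) = (fun y =>
  \sum_i a i * (wave (z i) y * osc th (phik phi0 k) (x - y)))); last exact/funext.
rewrite integ_Rintegral; last first.
  by apply: integrable_sum_EFin => i; exact: integrableZl_EFin.
rewrite Rintegral_sum; last by move=> i; exact: integrableZl_EFin.
by apply: eq_bigr => i _; rewrite RintegralZl.
Qed.

Lemma besov_block0_waves x :
  besov_block phi0 0 waves x = `|(sinc_mass / pi) ^+ d * waves x|.
Proof.
rewrite /besov_block psik_reE psik_imE !integ_waves_osc.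
have lowE th : \sum_i a i * \int[leb d]_y (wave (z i) y * osc th (phik phi0 0) (x - y)) =
    cos th * ((sinc_mass / pi) ^+ d * waves x).
  rewrite /waves !mulr_sumr; apply: eq_bigr => i _.
  by rewrite (wave_osc_low (integrable_phik 0))//; [ring|exact: phik0_in].
(* Phase 0 has cosine 1 and phase [- (pi / 2)] has cosine 0: the block is real. *)
by rewrite !lowE cos0 cosN cos_pihalf mul1r mul0r expr0n addr0 sqrtr_sqr.
Qed.

Lemma besov_blockS_waves k x : besov_block phi0 k.+1 waves x = 0.
Proof.
rewrite /besov_block psik_reE psik_imE !integ_waves_osc.
have highE th : \sum_i a i * \int[leb d]_y (wave (z i) y * osc th (phik phi0 k.+1) (x - y)) = 0.
  apply: big1 => i _; rewrite (wave_osc_high (integrable_phik k.+1)) ?mulr0//.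
  exact: phikS_in.
by rewrite !highE expr0n addr0 sqrtr0.
Qed.
End combination.
End blocks.
End waves.

(** * Inequalities for powers, and the Besov norm of a single block *)

Section norms.
Context {R : realType}.

(** Jensen's inequality for the power [r] with weights of total mass at most [B]. The weights will
    be the values [wave (z i) x] and [u] the moduli of the coefficients, so a pointwise overlap
    bound converts l^r coefficients into L^r functions. *)
Lemma powR_sum_le (I : finType) (P : pred I) (w u : I -> R) (B r : R) :
  1 < r -> 0 < B -> (forall i, 0 <= w i) -> (forall i, 0 <= u i) ->
  \sum_(i | P i) w i <= B ->
  (\sum_(i | P i) w i * u i) `^ r <= B `^ (r - 1) * \sum_(i | P i) w i * u i `^ r.
Proof.
move=> r1 B0 w0 u0 wB; have r0 : 0 < r by rewrite (lt_trans _ r1).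
set S := \sum_(i | P i) w i * u i.
have S0 : 0 <= S by apply: sumr_ge0 => i _; rewrite mulr_ge0.
set T := \sum_(i | P i) _.
have T0 : 0 <= T by apply: sumr_ge0 => i _; rewrite mulr_ge0 ?powR_ge0.
have [S00|Sn0] := eqVneq S 0.
  by rewrite S00 powR0 ?gt_eqF// mulr_ge0 ?powR_ge0.
have Sp : 0 < S by rewrite lt_def Sn0.
pose A := S / B; have A0 : 0 < A by rewrite divr_gt0.
have SA : S = A * B by rewrite /A divfK ?gt_eqF.
have AE : A `^ r = A * A `^ (r - 1).
  by rewrite -[X in X * _]powRr1 ?ltW// -powRD ?(gt_eqF A0) ?implybT//; congr powR; ring.
have BE : B `^ r = B * B `^ (r - 1).
  by rewrite -[X in X * _]powRr1 ?ltW// -powRD ?(gt_eqF B0) ?implybT//; congr powR; ring.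
(* Young's inequality against the average [A]: [u A^(r-1) <= u^r / r + (1 - 1/r) A^r] *)
have young i : u i * A `^ (r - 1) <= u i `^ r / r + A `^ r * (1 - r^-1).
  have q0 : 0 < r / (r - 1) by rewrite divr_gt0// subr_gt0.
  have := @conjugate_powR _ (u i) (A `^ (r - 1)) r (r / (r - 1)) (u0 i) (powR_ge0 _ _) r0 q0.
  have qE : (r / (r - 1))^-1 = 1 - r^-1.
    by field; rewrite subr_eq0 !gt_eqF.
  rewrite qE addrC subrK => /(_ erefl); rewrite -powRrM.
  by have -> : (r - 1) * (r / (r - 1)) = r by field; rewrite subr_eq0 gt_eqF.
have : S * A `^ (r - 1) <= T / r + B * (A `^ r * (1 - r^-1)).
  rewrite /S /T !mulr_suml; apply: (@le_trans _ _
      (\sum_(i | P i) (w i * u i `^ r / r + w i * (A `^ r * (1 - r^-1))))).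
    by apply: ler_sum => i _; rewrite -!mulrA -mulrDr ler_wpM2l.
  rewrite big_split /= lerD2l -mulr_suml ler_wpM2r// mulr_ge0 ?powR_ge0//.
  by rewrite subr_ge0 invf_le1// ltW.
rewrite SA mulrAC -AE => H.
have ri : 0 < r^-1 by rewrite invr_gt0.
(* Cancelling [B * A^r * (1 - 1/r)] leaves [A^r * B / r <= T / r]. *)
have {}H : A `^ r * B <= T by nra.
have -> : (A * B) `^ r = B `^ (r - 1) * (A `^ r * B).
  by rewrite powRM ?ltW// BE; ring.
by rewrite ler_wpM2l ?powR_ge0.
Qed.

(** Excludes negative essential bounds of a nonnegative function in [esssupd_bounds]. *)
Lemma intd_cst1_neq0 n : intd (fun _ : 'rV[R]_n => 1%E) <> 0%E.
Proof.
suff : (0 < intd (fun _ : 'rV[R]_n => 1%E))%E by move=> /[swap] ->; rewrite ltxx.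
elim: n => [|n IHn] /=; first by rewrite lte01.
rewrite integral_cst//=; have -> : lebesgue_measure [set: R] = +oo%E.
  by rewrite -set_itvNyy lebesgue_measure_itv.
by rewrite gt0_muley// ltey.
Qed.

Lemma intd0 n : intd (fun _ : 'rV[R]_n => 0%E) = 0%E.
Proof. by elim: n => //= n ->; rewrite integral0. Qed.

Lemma esssupd_bounds n (h : 'rV[R]_n -> R) (C : R) :
  (forall x, 0 <= h x <= C) -> (0 <= esssupd h <= C%:E)%E.
Proof.
move=> hC; apply/andP; split.
  apply: le_ereal_inf_tmp => M /= hM; rewrite leNgt; apply/negP => M0.
  apply: (@intd_cst1_neq0 n); rewrite -[RHS]hM; congr intd; apply/funext => x.
  rewrite indicE mem_set//=; have /andP[hx _] := hC x.
  by rewrite (lt_le_trans M0)// lee_fin.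
apply: ereal_inf_lbound => /=; rewrite -[RHS](intd0 n); congr intd.
apply/funext => x; rewrite indicE memNset//= => /lt_geF.
by have /andP[_ hx] := hC x; rewrite lee_fin hx.
Qed.

Lemma Lpnormd0 n (p : \bar R) : (0 < p)%E ->
  Lpnormd p (fun _ : 'rV[R]_n => 0) = 0%E.
Proof.
case: p => [r||]//; rewrite /Lpnormd ?lte_fin => r0.
  by rewrite normr0 powR0 ?gt_eqF// intd0 /= powR0// invr_eq0 gt_eqF.
apply/eqP; rewrite eq_le andbC; apply: esssupd_bounds => x.
by rewrite normr0 lexx.
Qed.

(** Repeats the [match] of [besov_norm] for an abstract sequence [N], so that the case analysis on
    [q] is done apart from the blocks. *)
Lemma lq_norm_single (N : nat -> \bar R) (q : \bar R) (v : R) :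
  (1%:E <= q)%E -> 0 <= v -> N 0%N = v%:E -> (forall k, N k.+1 = 0%:E) ->
  match q with
  | +oo%E => ereal_sup (range N)
  | r%:E =>
      match (\sum_(0 <= k <oo) (match N k with
                                | v%:E => (v `^ r)%:E
                                | _ => +oo%E end))%E with
      | v%:E => (v `^ r^-1)%:E
      | +oo%E => +oo%E
      | -oo%E => 0%E
      end
  | -oo%E => 0%E
  end = v%:E.
Proof.
move=> q1 v0 N0 NS; case: q q1 => [r||]//; last first.
  move=> _; apply/eqP; rewrite eq_le; apply/andP; split.
    by apply: ub_ereal_sup => _ [[|k] _ <-]; rewrite ?N0 ?NS.
  by apply: ereal_sup_ubound; exists 0%N.
rewrite lee_fin => r1; have r0 : 0 < r by rewrite (lt_le_trans _ r1).
rewrite nneseries_recl//; last first.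
  by move=> [|k] _; rewrite ?N0 ?NS lee_fin powR_ge0.
rewrite N0 eseries0; last first.
  by move=> [|k]// _ _; rewrite NS powR0// gt_eqF.
by rewrite adde0 -powRrM divff ?gt_eqF// powRr1.
Qed.

Lemma besov_norm_single n (phi0 : 'rV[R]_n -> R) (s : R) (p q : \bar R) f (v : R) :
  (0 < p)%E -> (1%:E <= q)%E -> 0 <= v ->
  Lpnormd p (besov_block phi0 0 f) = v%:E ->
  (forall k x, besov_block phi0 k.+1 f x = 0) ->
  besov_norm phi0 s p q f = v%:E.
Proof.
move=> p0 q1 v0 f0 fS.
have bS k : besov_block phi0 k.+1 f = fun=> 0 by apply/funext => x; rewrite fS.
apply: (@lq_norm_single (fun k =>
  (((2:R) `^ (k%:R * s))%:E * Lpnormd p (besov_block phi0 k f))%E)) => //.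
  by rewrite mul0r powRr0 mul1e.
by move=> k; rewrite bS Lpnormd0// mule0.
Qed.
End norms.

(** * Combinations of waves in the unit ball *)

Section waves_in_ball.
Context {R : realType} {d : nat}.
Hypothesis d0 : (0 < d)%N.
Variables (phi0 : 'rV[R]_d -> R) (s : R) (p q : \bar R).
Hypothesis cut : besov_cutoff phi0.
Hypotheses (p2 : (2%:E < p)%E) (q1 : (1%:E <= q)%E).

Definition wave_mass : R :=
  \prod_(i < d) \int[@lebesgue_measure R]_t sincsq (bandwidth (R := R) (d := d)) t.

(** Frequency 0 and phase 0 reduce [integral_prod_phase] to a product of one-dimensional masses. *)
Lemma Rintegral_wave (z : 'rV[R]_d) : \int[leb d]_x wave z x = wave_mass.
Proof.
have si := @integrable_sincsq R (bandwidth (R := R) (d := d)).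
pose u (i : 'I_d) t := sincsq (bandwidth (R := R) (d := d)) (t - z ord0 i).
have ui i : (@lebesgue_measure R).-integrable setT (EFin \o u i).
  exact: integrable_shift.
have uE i th : \int[@lebesgue_measure R]_t (u i t * cos (th + 0 * t)) =
    cos (th + 0) * \int[@lebesgue_measure R]_t sincsq (bandwidth (R := R) (d := d)) t.
  under eq_Rintegral do rewrite mul0r.
  rewrite RintegralZr// mulrC; congr (_ * _).
  by rewrite /u Rintegral_shift//; exact: measurable_sincsq.
have := integral_prod_phase ui uE 0; rewrite big1// addr0 cos0 mul1r /wave_mass => <-.
apply: eq_Rintegral => x _; rewrite [X in cos (_ + X)]big1 ?addr0 ?cos0 ?mulr1// => i _.
by rewrite mul0r.
Qed.

Lemma wave_mass_ge0 : 0 <= wave_mass.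
Proof. by rewrite -(Rintegral_wave 0); apply: Rintegral_ge0 => x _; exact: wave_ge0. Qed.

Lemma sinc_mass_ge0 : 0 <= sinc_mass (R := R).
Proof. by apply: Rintegral_ge0 => t _; exact: sincsq_ge0. Qed.

(** One normalisation for all exponents: [B] bounds the overlap of the waves, [wave_mass] is the L^1
    norm of one wave, and the summand 1 keeps the scale positive given just [sinc_mass >= 0]. *)
Definition ball_scale (B : R) : R :=
  (sinc_mass / pi) ^+ d * (B + wave_mass) + 1.

Lemma ball_scale_gt0 B : 0 < B -> 0 < ball_scale B.
Proof.
move=> B0; rewrite /ball_scale ltr_wpDl// mulr_ge0//.
  by rewrite exprn_ge0// divr_ge0 ?sinc_mass_ge0 ?pi_ge0.
by rewrite addr_ge0 ?wave_mass_ge0// ltW.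
Qed.

Section combination.
Variables (I : finType) (a : I -> R) (z : I -> 'rV[R]_d) (B : R).
Hypothesis B0 : 0 < B.
(** Restricted to nonzero coefficients because the index types used later contain junk indices,
    which carry coefficient 0. *)
Hypothesis zB : forall x, \sum_(i | a i != 0) wave (z i) x <= B.
Hypothesis a1 : forall i, `|a i| <= 1.
Hypothesis ap : forall r, p = r%:E -> \sum_i `|a i| `^ r <= 1.

Let L := ball_scale B.
Let f := waves (fun i => L^-1 * a i) z.
Let K : R := (sinc_mass / pi) ^+ d.

Let K0 : 0 <= K.
Proof. by rewrite exprn_ge0// divr_ge0 ?sinc_mass_ge0 ?pi_ge0. Qed.

Let L0 : 0 < L. Proof. exact: ball_scale_gt0. Qed.

Let S x := \sum_(i | a i != 0) wave (z i) x * `|a i|.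

Let S0 x : 0 <= S x.
Proof. by apply: sumr_ge0 => i _; rewrite mulr_ge0 ?wave_ge0. Qed.

Let fS x : `|f x| <= L^-1 * S x.
Proof.
rewrite /f /waves (bigID (fun i => a i == 0)) /= big1 ?add0r; last first.
  by move=> i /eqP ->; rewrite mulr0 mul0r.
rewrite (le_trans (ler_norm_sum _ _ _))// /S mulr_sumr; apply: ler_sum => i _.
rewrite !normrM (ger0_norm (wave_ge0 _ _)) gtr0_norm ?invr_gt0//.
by rewrite -mulrA (mulrC (wave _ _)).
Qed.

Let SB x : S x <= B.
Proof.
rewrite (le_trans _ (zB x))//; apply: ler_sum => i _.
by rewrite ler_piMr// wave_ge0.
Qed.

Let fB x : `|f x| <= L^-1 * B.
Proof. by rewrite (le_trans (fS x))// ler_wpM2l ?invr_ge0 ?SB ?(ltW L0). Qed.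

Let cf : continuous f.
Proof.
rewrite /f /waves; move: (index_enum _) => r.
elim: r => [|i r IHr].
  by under [X in continuous X]eq_fun do rewrite big_nil; exact: cst_continuous.
under [X in continuous X]eq_fun do rewrite big_cons.
have cw : continuous (fun x => L^-1 * a i * wave (z i) x).
  by move=> x; exact: cvgM (@cvg_cst _ _ _ _ _) (@continuous_wave _ _ (z i) x).
by move=> x; exact: cvgD (cw x) (IHr x).
Qed.

Let KBL : K * (L^-1 * B) <= 1.
Proof.
rewrite mulrCA mulrC ler_pdivrMr// mul1r /L /ball_scale -/K.
by rewrite ler_wpDr// ler_wpM2l// lerDl wave_mass_ge0.
Qed.

(** For [p = +oo] the sup bound [KBL] suffices. For finite [p = r], [powR_sum_le] bounds the r-th
    power of the block pointwise by [c] times the sum of [|a i|^r * wave (z i)], whose integral is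
    at most [c * wave_mass]. *)
Let block_norm : exists2 v : R, 0 <= v <= 1 &
  Lpnormd p (besov_block phi0 0 f) = v%:E.
Proof.
have -> : besov_block phi0 0 f = fun x => `|K * f x|.
  by apply/funext => x; rewrite besov_block0_waves.
case: p p2 ap => [r||]//; last first.
  move=> _ _; rewrite /Lpnormd.
  have /andP[e0 e1] : (0 <= esssupd (fun x : 'rV[R]_d => `|(`|K * f x|)|)%R <= 1%:E)%E.
    apply: esssupd_bounds => x; rewrite normr_id normr_ge0/=.
    by rewrite normrM (ger0_norm K0) (le_trans _ KBL)// ler_wpM2l.
  exists (fine (esssupd (fun x : 'rV[R]_d => `|(`|K * f x|)|))).
    rewrite fine_ge0//= -lee_fin fineK// ge0_fin_numE//.
    exact: le_lt_trans e1 (ltry _).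
  by rewrite fineK// ge0_fin_numE//; exact: le_lt_trans e1 (ltry _).
rewrite lte_fin => r2 /(_ _ erefl) ar; rewrite /Lpnormd.
have r1 : 1 < r by rewrite (lt_trans _ r2)// ltr1n.
have r0 : 0 < r by rewrite (lt_trans _ r1).
have mf : measurable_fun [set: 'rV[R]_d] (fun x : 'rV[R]_d => `|(`|K * f x|)| `^ r).
  apply: (measurableT_comp (measurable_powR r)).
  apply: measurableT_comp => //; apply: measurableT_comp => //.
  by apply: measurable_funM => //; exact: continuous_rv_measurable.
pose c := (K * L^-1) `^ r * B `^ (r - 1).
have c0 : 0 <= c by rewrite mulr_ge0 ?powR_ge0.
pose g x := c * \sum_i `|a i| `^ r * wave (z i) x.
have fg x : `|(`|K * f x|)| `^ r <= g x.
  rewrite normr_id normrM (ger0_norm K0) /g /c -mulrA.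
  apply: (@le_trans _ _ ((K * (L^-1 * S x)) `^ r)).
    by rewrite ge0_ler_powR ?nnegrE ?(ltW r0) ?mulr_ge0 ?invr_ge0 ?(ltW L0)// ler_wpM2l.
  have -> : (K * (L^-1 * S x)) `^ r = (K * L^-1) `^ r * S x `^ r.
    by rewrite mulrA powRM// mulr_ge0 ?invr_ge0 ?(ltW L0).
  rewrite ler_wpM2l ?powR_ge0//.
  apply: (@le_trans _ _ (B `^ (r - 1) * \sum_(i | a i != 0) wave (z i) x * `|a i| `^ r)).
    by apply: powR_sum_le => // i; exact: wave_ge0.
  rewrite ler_wpM2l ?powR_ge0// [leRHS](bigID (fun i => a i != 0)) /= ler_wpDr//.
    by apply: sumr_ge0 => i _; rewrite mulr_ge0 ?powR_ge0 ?wave_ge0.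
  by rewrite le_eqVlt; apply/orP; left; apply/eqP; apply: eq_bigr => i _; rewrite mulrC.
have wi i : (leb d).-integrable setT (EFin \o (fun x => `|a i| `^ r * wave (z i) x)).
  by apply: integrableZl_EFin; exact: integrable_wave.
have gi : (leb d).-integrable setT (EFin \o g).
  by apply: integrableZl_EFin; exact: integrable_sum_EFin.
have W0 := wave_mass_ge0.
have gE : \int[leb d]_x g x <= c * wave_mass.
  rewrite RintegralZl//; last exact: integrable_sum_EFin.
  rewrite ler_wpM2l// Rintegral_sum//.
  rewrite (eq_bigr (fun i => `|a i| `^ r * wave_mass)) => [|i _].
    by rewrite -mulr_suml ler_piMl.
  by rewrite RintegralZl ?Rintegral_wave//; exact: integrable_wave.
rewrite intdE; [|by apply/measurable_EFinP|by move=> x; rewrite lee_fin powR_ge0].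
have fi : (leb d).-integrable setT (EFin \o (fun x : 'rV[R]_d => `|(`|K * f x|)| `^ r)).
  apply: (@le_integrable _ _ _ (leb d) setT _ _ (EFin \o g)) => //.
    exact/measurable_EFinP.
  move=> x _ /=; rewrite lee_fin ger0_norm ?powR_ge0//.
  by rewrite (le_trans (fg x))// ler_norm.
rewrite EFin_Rintegral//; set v := \int[leb d]_x _; exists (v `^ r^-1) => //.
rewrite powR_ge0 /= -[leRHS](congr1 (fun h => h r^-1) (@powR1 R)).
have v0 : 0 <= v by apply: Rintegral_ge0 => x _; rewrite powR_ge0.
rewrite ge0_ler_powR ?nnegrE ?invr_ge0 ?(ltW r0)//.
apply: (@le_trans _ _ (\int[leb d]_x g x)); first exact: le_Rintegral.
apply: (le_trans gE).
have BW : 0 < B + wave_mass by rewrite ltr_pwDl.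
(* [B^(r-1) * wave_mass <= (B + wave_mass)^r], and [K * (B + wave_mass) <= L] by the choice of
   [ball_scale], so the r-th power stays below 1 for every [r]. *)
apply: (@le_trans _ _ ((K * L^-1) `^ r * (B + wave_mass) `^ r)).
  rewrite /c -mulrA ler_wpM2l ?powR_ge0//.
  have -> : (B + wave_mass) `^ r = (B + wave_mass) `^ (r - 1) * (B + wave_mass).
    rewrite -[X in _ * X]powRr1 ?ltW// -powRD ?(gt_eqF BW) ?implybT//.
    by congr powR; ring.
  apply: ler_pM; rewrite ?powR_ge0// ?lerDr ?(ltW B0)//.
  by rewrite ge0_ler_powR ?nnegrE ?(ltW B0) ?(ltW BW) ?subr_ge0 ?(ltW r1)// lerDl.
rewrite -powRM ?mulr_ge0 ?invr_ge0 ?(ltW L0) ?(ltW BW)//.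
rewrite -[leRHS](congr1 (fun h => h r) (@powR1 R)) ge0_ler_powR ?nnegrE ?(ltW r0)//.
  by rewrite !mulr_ge0 ?invr_ge0 ?(ltW L0) ?(ltW BW).
rewrite mulrAC ler_pdivrMr// mul1r /L /ball_scale -/K.
by rewrite lerDl.
Qed.

Lemma waves_in_ball : besov_unit_ball phi0 s p q f.
Proof.
split; first exact: cf.
split; first by exists (L^-1 * B).
have [v /andP[v0 v1] vE] := block_norm.
rewrite (@besov_norm_single _ _ _ _ _ _ _ v)//.
  by rewrite (lt_trans _ p2)// lte_fin.
by move=> k x; rewrite besov_blockS_waves.
Qed.
End combination.
End waves_in_ball.

(** * Gaussian processes with bounded paths *)

Section gaussian.
Context {R : realType} {d' : measure_display} {Omega : measurableType d'}.
Variable Pr : probability Omega R.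

(** Length [sg] of the interval times the peak of the density is [1 / sqrt (2 pi)], at most 1/2
    since [pi >= 2]. *)
Lemma normal_prob_small (sg : R) : 0 < sg ->
  (normal_prob 0 sg `](- (sg / 2))%R, (sg / 2)%R[%classic <= (2^-1)%:E)%E.
Proof.
move=> s0; rewrite /normal_prob.
have sn0 : sg != 0 by rewrite gt_eqF.
apply: (@le_trans _ _ (\int[lebesgue_measure]_(x in `](- (sg / 2))%R, (sg / 2)%R[)
   (normal_peak sg)%:E)%E).
  apply: ge0_le_integral => //.
  - by move=> x _; rewrite lee_fin normal_pdf_ge0.
  - by apply/measurable_EFinP; apply: measurable_funTS; exact: measurable_normal_pdf.
  - by move=> x _; rewrite lee_fin normal_pdf_ub.
rewrite integral_cst//= lebesgue_measure_itv /= lte_fin gtrN ?divr_gt0//.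
rewrite -EFinB -EFinM lee_fin opprK -splitr /normal_peak.
rewrite -(@ler_pM2r _ (Num.sqrt (sg ^+ 2 * pi *+ 2))); last first.
  by rewrite sqrtr_gt0 mulrn_wgt0// mulr_gt0 ?exprn_gt0 ?pi_gt0.
rewrite mulrAC mulVf ?mul1r; last first.
  by rewrite gt_eqF// sqrtr_gt0 mulrn_wgt0// mulr_gt0 ?exprn_gt0 ?pi_gt0.
rewrite ler_pdivlMl// -[leLHS]ger0_norm ?mulr_ge0 ?(ltW s0)// -sqrtr_sqr ler_sqrt; last first.
  by rewrite mulrn_wge0// mulr_ge0 ?sqr_ge0 ?pi_ge0.
have := pi_ge2 R; have : 0 < sg ^+ 2 by rewrite exprn_gt0.
rewrite exprMn -mulr_natr; nra.
Qed.

(** Anti-concentration at half a standard deviation. For [v = 0] the threshold is 0 and the event is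
    certain. *)
Lemma gauss_law_large (X : Omega -> R) (v : R) : measurable_fun setT X -> 0 <= v ->
  (forall A, measurable A -> Pr (X @^-1` A) = gauss_law v A) ->
  ((2^-1)%:E <= Pr [set w | Num.sqrt v / 2 <= `|X w|]%R)%E.
Proof.
move=> mX v0 law; have [->|vn0] := eqVneq v 0.
  rewrite sqrtr0 mul0r (_ : [set w | _] = setT); last by apply/seteqP; split => // w _ /=.
  by rewrite probability_setT lee_fin invf_le1// ler1n.
have s0 : 0 < Num.sqrt v by rewrite sqrtr_gt0 lt_def vn0.
pose A : set R := `](- (Num.sqrt v / 2)), (Num.sqrt v / 2)[%classic.
have -> : [set w | Num.sqrt v / 2 <= `|X w|] = ~` (X @^-1` A).
  apply/seteqP; split => w; rewrite /A /= in_itv /= -ltr_norml.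
    by rewrite leNgt => /negP.
  by move=> /negP; rewrite -leNgt.
have mI : measurable A by exact: measurable_itv.
have mA : measurable (X @^-1` A).
  by have := mX measurableT A mI; rewrite setTI.
rewrite probability_setC// law// /gauss_law (negbTE vn0).
have := normal_prob_small s0; rewrite -/A.
case: (normal_prob 0 _ A) => [r| |] H; [|by rewrite leye_eq in H|by rewrite leey].
move: H; rewrite -EFinB !lee_fin; lra.
Qed.

Variables (X : Type) (F : set X) (G : X -> Omega -> R) (cov : X -> X -> R).
Hypothesis mG : forall f, F f -> measurable_fun [set: Omega] (G f).
Hypothesis law : forall (n : nat) (fs : 'I_n -> X) (a : 'I_n -> R),
  (forall i, F (fs i)) -> forall A : set R, measurable A ->
  Pr ((fun w => \sum_(i < n) a i * G (fs i) w) @^-1` A) =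
  gauss_law (\sum_(i < n) \sum_(j < n) a i * a j * cov (fs i) (fs j)) A.

Lemma process_large f : F f -> 0 <= cov f f ->
  ((2^-1)%:E <= Pr [set w | Num.sqrt (cov f f) / 2 <= `|G f w|]%R)%E.
Proof.
move=> Ff c0; apply: gauss_law_large => //; first exact: mG.
move=> A mA; have := @law 1 (fun=> f) (fun=> 1) (fun=> Ff) A mA.
rewrite !big_ord1 !mul1r => <-; congr (Pr _).
by apply/seteqP; split => w /=; rewrite big_ord1 mul1r.
Qed.

(** The hypothesis says that [G f - \sum_i a i * G (e i)] has variance 0, so its law is the Dirac
    mass at 0. *)
Lemma process_linear (I : finType) (a : I -> R) (e : I -> X) (f : X) :
  F f -> (forall i, F (e i)) ->
  cov f f - \sum_i a i * cov f (e i) - \sum_i a i * cov (e i) f +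
    \sum_i \sum_j a i * a j * cov (e i) (e j) = 0 ->
  {ae Pr, forall w, G f w = \sum_i a i * G (e i) w}.
Proof.
move=> Ff Fe c0.
(* The law is given for families indexed by ordinals: index 0 holds [f] with coefficient 1, the
   others enumerate [I] with coefficients [- a]. *)
pose fs (k : 'I_#|I|.+1) := if unlift ord0 k is Some j then e (enum_val j) else f.
pose b (k : 'I_#|I|.+1) := if unlift ord0 k is Some j then - a (enum_val j) else 1.
have Ffs k : F (fs k) by rewrite /fs; case: unliftP.
have fs0 : fs ord0 = f by rewrite /fs unlift_none.
have b0 : b ord0 = 1 by rewrite /b unlift_none.
have fsS j : fs (lift ord0 j) = e (enum_val j) by rewrite /fs liftK.
have bS j : b (lift ord0 j) = - a (enum_val j) by rewrite /b liftK.
have sumE (h : I -> R) : \sum_(j < #|I|) h (enum_val j) = \sum_i h i.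
  by rewrite -(big_enum_val (A := I)).
have H1 : \sum_(j < #|I|) b ord0 * b (lift ord0 j) * cov (fs ord0) (fs (lift ord0 j)) =
    - \sum_i a i * cov f (e i).
  rewrite -sumrN -sumE; apply: eq_bigr => j _.
  by rewrite fs0 b0 fsS bS mul1r mulNr.
have H2 : \sum_(i < #|I|) b (lift ord0 i) * b ord0 * cov (fs (lift ord0 i)) (fs ord0) =
    - \sum_i a i * cov (e i) f.
  rewrite -sumrN -sumE; apply: eq_bigr => j _.
  by rewrite fs0 b0 fsS bS mulr1 mulNr.
have H3 : \sum_(i < #|I|) \sum_(j < #|I|) b (lift ord0 i) * b (lift ord0 j) *
      cov (fs (lift ord0 i)) (fs (lift ord0 j)) =
    \sum_i \sum_j a i * a j * cov (e i) (e j).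
  rewrite -sumE; apply: eq_bigr => i _; rewrite -sumE; apply: eq_bigr => j _.
  by rewrite !fsS !bS mulrNN.
have := @law _ fs b Ffs [set 0] (measurable_set1 _).
have -> : \sum_(i < #|I|.+1) \sum_(j < #|I|.+1) b i * b j * cov (fs i) (fs j) = 0.
  rewrite -[RHS]c0 big_ord_recl big_ord_recl H1 b0 fs0 !mul1r -!addrA.
  congr (_ + (_ + _)); under eq_bigr do rewrite big_ord_recl.
  by rewrite big_split /= H2 H3.
rewrite /gauss_law eqxx diracE mem_set//; set S := _ @^-1` _ => PS.
have mS : measurable S.
  have mF : measurable_fun setT (fun w => \sum_(i < #|I|.+1) b i * G (fs i) w).
    by apply: measurable_sum => i; apply: measurable_funM => //; exact: mG.
  by rewrite /S -[X in measurable X]setTI; exact: (mF measurableT _ (measurable_set1 0)).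
exists (~` S); split; first exact: measurableC.
  by rewrite [LHS]probability_setC// PS subee.
apply: subsetC => w; rewrite /S /= big_ord_recl b0 fs0 mul1r.
under [X in _ + X]eq_bigr do rewrite fsS bS mulNr.
by rewrite sumrN (sumE (fun i => a i * G (e i) w)) => /eqP; rewrite subr_eq0 => /eqP.
Qed.

(* Choosing the signs of a combination pointwise turns its value into the weighted
   sum of absolute values, whose size is read off the one-dimensional marginals;
   no moment estimate is needed. *)
Lemma process_unbounded (I : nat -> finType) (e : forall M, I M -> X)
    (a : forall M, I M -> R) (comb : forall M, {ffun I M -> bool} -> X) :
  (forall w, exists C : R, forall f, F f -> `|G f w| <= C) ->
  (forall M i, F (e M i)) -> (forall M i, 0 <= cov (e M i) (e M i)) ->
  (forall M i, 0 <= a M i) -> (forall M s, F (comb M s)) ->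
  (forall M s, {ae Pr, forall w, G (comb M s) w =
     \sum_i (-1) ^+ s i * a M i * G (e M i) w}) ->
  (forall C : R, exists M, C < \sum_i a M i * Num.sqrt (cov (e M i) (e M i))) ->
  False.
Proof.
move=> bG Fe ce a0 Fc lin unb.
(* On [E K] one bound [K] serves all sign combinations for all [M] at once, so that [M] can be
   chosen after [K]. *)
pose E (K : nat) : set Omega := \bigcap_M \bigcap_(s in [set: {ffun I M -> bool}])
  [set w | `|G (comb M s) w| <= K%:R].
have mle f (K : R) : F f -> measurable [set w | `|G f w| <= K].
  move=> Ff; rewrite (_ : [set w | _] = (G f) @^-1` `[- K, K]).
    by rewrite -[X in measurable X]setTI; exact: mG.
  by apply/seteqP; split => w /=; rewrite in_itv /= ler_norml.
have mE K : measurable (E K).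
  apply: bigcapT_measurable => M; apply: fin_bigcap_measurable => // s _.
  exact: mle.
have ET : \bigcup_K E K = setT.
  apply/seteqP; split => // w _; have [C GC] := bG w.
  exists (Num.trunc `|C|).+1 => // M _ s _ /=.
  rewrite (le_trans (GC _ (Fc M s)))// (le_trans (ler_norm _))// ltW//.
  exact: real_truncnS_gt.
have ndE : nondecreasing_seq E.
  move=> K L KL; apply/subsetPset => w Ew M _ s _ /=.
  by rewrite (le_trans (Ew M Logic.I s Logic.I))// ler_nat.
have cvgE : Pr (E K) @[K --> \oo] --> (1 : \bar R)%E.
  rewrite -(@probability_setT _ _ _ Pr) -ET; apply: nondecreasing_cvg_mu => //.
  exact: bigcup_measurable.
have finPr A : measurable A -> Pr A = (fine (Pr A))%:E.
  by move=> mA; rewrite fineK// fin_num_measure.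
have [K PK] : exists K, 3 / 4 <= fine (Pr (E K)).
  have : fine (Pr (E K)) @[K --> \oo] --> (1 : R) by exact: fine_cvg cvgE.
  move=> /(@cvgr_ge _ _ _ _ _ _) /(_ (3 / 4)) H.
  have : 3 / 4 < (1 : R) by lra.
  by move=> /H [K _ /(_ K (leqnn K))] HK; exists K.
(* 8 = 2 * 4: the threshold [sg i / 2] costs a factor 1/2, the probability in [PAE] a factor 1/4. *)
have [M CM] := unb (8 * K%:R).
pose sg i := Num.sqrt (cov (e M i) (e M i)).
pose A i := [set w | sg i / 2 <= `|G (e M i) w|].
have mA i : measurable (A i).
  have mN : measurable_fun setT (fun w => `|G (e M i) w|).
    by apply: measurableT_comp => //; exact: mG.
  rewrite (_ : A i = (fun w => `|G (e M i) w|) @^-1` `[sg i / 2, +oo[).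
    by rewrite -[X in measurable X]setTI; exact: mN.
  by apply/seteqP; split => w; rewrite /A /= in_itv /= andbT.
have PA i : 2^-1 <= fine (Pr (A i)).
  by rewrite -lee_fin -finPr//; apply: process_large.
(* [A i] has probability at least 1/2, the complement of [E K] at most 1/4. *)
have PAE i : 4^-1 <= fine (Pr (A i `&` E K)).
  have mAE : measurable (A i `&` E K) by exact: measurableI.
  have mDE : measurable (E K `\` A i) by exact: measurableD.
  have EE : Pr (E K) = (Pr (E K `\` A i) + Pr (A i `&` E K))%E.
    by rewrite setIC; exact: measureDI.
  have H : (Pr (E K `\` A i) <= Pr (~` A i))%E.
    by apply: le_measure; rewrite ?inE//; [exact: measurableC|..] => w [].
  rewrite probability_setC// (finPr _ (mA i)) (finPr _ mDE) -EFinB lee_fin in H.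
  rewrite (finPr _ (mE K)) (finPr _ mDE) (finPr _ mAE) -EFinD in EE.
  have := EFin_inj EE; have := PA i; lra.
(* A simple function lying below the weighted sum of [|G (e M i) w|] on [E K], and equal to 0 off
   it. *)
pose f w := \sum_i (a M i * (sg i / 2)) * \1_(A i `&` E K) w.
have ii i : Pr.-integrable setT (EFin \o (fun w => (a M i * (sg i / 2)) * \1_(A i `&` E K) w)).
  apply: integrableZl_EFin; rewrite /comp; apply: integrable_indic => //.
  exact: measurableI.
have fK : {ae Pr, forall w, f w <= K%:R}.
  (* There are finitely many sign patterns [s], so the union of their null sets is null and the
     signs may depend on [w]. *)
  have : {ae Pr, forall w, forall s, G (comb M s) w =
     \sum_i (-1) ^+ s i * a M i * G (e M i) w} by apply: filter_forall; exact: lin.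
  apply: filterS => w Gw; rewrite /f.
  have [Ew|nEw] := pselect (E K w); last first.
    rewrite big1 // => i _; rewrite indicE memNset ?mulr0//.
    by move=> [].
  pose s : {ffun I M -> bool} := [ffun i => G (e M i) w < 0].
  apply: le_trans (Ew M Logic.I s Logic.I); rewrite /= Gw.
  apply: le_trans (ler_norm _); apply: ler_sum => i _.
  have -> : (-1) ^+ s i * a M i * G (e M i) w = a M i * `|G (e M i) w|.
    rewrite mulrAC mulrC; congr (_ * _); rewrite ffunE.
    case: ltrP => G0; rewrite ?expr1 ?expr0 ?mulN1r ?mul1r.
      by rewrite ltr0_norm.
    by rewrite ger0_norm.
  rewrite -mulrA ler_wpM2l// indicE; case: (boolP (w \in _)) => [|_].
    by rewrite inE => -[Aw _]; rewrite mulr1.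
  by rewrite mulr0.
have fi : Pr.-integrable setT (EFin \o f) by exact: integrable_sum_EFin.
have f0 w : 0 <= f w.
  by apply: sumr_ge0 => i _; rewrite !mulr_ge0 ?divr_ge0 ?sqrtr_ge0.
have If : \int[Pr]_w f w <= K%:R.
  rewrite -lee_fin -EFin_Rintegral//.
  apply: (@le_trans _ _ (\int[Pr]_w (K%:R)%:E)%E); last first.
    have PT : Pr setT = 1%E := probability_setT Pr.
    by rewrite integral_cst// [X in (_ * X)%E]PT mule1.
  apply: ae_ge0_le_integral => //.
  - by move=> w _; rewrite lee_fin.
  - exact: measurable_int fi.
  - have [N [mN N0 sN]] := fK; exists N; split => //.
    by apply: subset_trans sN; apply: subsetC => w /= fw _; rewrite lee_fin.
have : \int[Pr]_w f w = \sum_i (a M i * (sg i / 2)) * fine (Pr (A i `&` E K)).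
  rewrite /f Rintegral_sum//; apply: eq_bigr => i _.
  rewrite RintegralZl//; last first.
    by rewrite /comp; apply: integrable_indic => //; exact: measurableI.
  by rewrite /Rintegral integral_indic ?setIT//; exact: measurableI.
have : 8^-1 * \sum_i a M i * sg i <= \sum_i (a M i * (sg i / 2)) * fine (Pr (A i `&` E K)).
  rewrite mulr_sumr; apply: ler_sum => i _.
  have -> : 8^-1 * (a M i * sg i) = (a M i * (sg i / 2)) * 4^-1 by field.
  by rewrite ler_wpM2l// mulr_ge0// divr_ge0 ?sqrtr_ge0.
rewrite -/sg in CM; lra.
Qed.
End gaussian.

(** * The covariance of the Brownian bridge *)

Section weighted.
Context {R : realType} {d : nat}.
Variable rho : 'rV[R]_d -> R.
Hypothesis rhoi : (leb d).-integrable setT (EFin \o rho).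

Definition weighted (h : 'rV[R]_d -> R) : R := integ (fun x => h x * rho x).

Definition weighted_cov (f g : 'rV[R]_d -> R) : R :=
  weighted (fun x => (f x - weighted f) * (g x - weighted g)).

Definition bounded_meas (h : 'rV[R]_d -> R) : Prop :=
  measurable_fun setT h /\ exists M, forall x, `|h x| <= M.

Lemma bounded_measB h (c : R) : bounded_meas h -> bounded_meas (fun x => h x - c).
Proof.
move=> [mh [M hM]]; split; first exact: measurable_funB.
by exists (M + `|c|) => x; rewrite (le_trans (ler_normB _ _))// lerD.
Qed.

Lemma bounded_measM g h : bounded_meas g -> bounded_meas h ->
  bounded_meas (fun x => g x * h x).
Proof.
move=> [mg [M gM]] [mh [N hN]]; split; first exact: measurable_funM.
exists (M * N) => x; rewrite normrM ler_pM//.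
Qed.

Lemma integrable_weighted h : bounded_meas h ->
  (leb d).-integrable setT (EFin \o (fun x => h x * rho x)).
Proof.
move=> [mh [M hM]].
under [X in EFin \o X]eq_fun do rewrite mulrC.
exact: (@integrable_mul_bounded _ _ _ (leb d) rho h M).
Qed.

Lemma weightedE h : bounded_meas h -> weighted h = \int[leb d]_x (h x * rho x).
Proof. by move=> bh; rewrite /weighted integ_Rintegral//; exact: integrable_weighted. Qed.

Lemma weighted_sum (I : finType) (a : I -> R) (e : I -> 'rV[R]_d -> R) h :
  (forall i, bounded_meas (e i)) -> (forall x, h x = \sum_i a i * e i x) ->
  weighted h = \sum_i a i * weighted (e i).
Proof.
move=> be hE; rewrite /weighted.
have -> : (fun x => h x * rho x) = (fun x => \sum_i a i * (e i x * rho x)).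
  apply/funext => x; rewrite hE mulr_suml; apply: eq_bigr => i _.
  by rewrite mulrA.
rewrite integ_Rintegral; last first.
  apply: integrable_sum_EFin => i; apply: integrableZl_EFin.
  exact: integrable_weighted.
rewrite Rintegral_sum; last first.
  by move=> i; apply: integrableZl_EFin; exact: integrable_weighted.
apply: eq_bigr => i _; rewrite RintegralZl//; last exact: integrable_weighted.
by rewrite -weightedE.
Qed.

Lemma weighted_cov_suml (I : finType) (a : I -> R) (e : I -> 'rV[R]_d -> R) f g :
  (forall i, bounded_meas (e i)) -> bounded_meas g ->
  (forall x, f x = \sum_i a i * e i x) ->
  weighted_cov f g = \sum_i a i * weighted_cov (e i) g.
Proof.
move=> be bg fE; rewrite /weighted_cov.
apply: (@weighted_sum _ _ (fun i x => (e i x - weighted (e i)) * (g x - weighted g))).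
  by move=> i; apply: bounded_measM; exact: bounded_measB.
move=> x; rewrite (weighted_sum be fE) fE -sumrB mulr_suml.
by apply: eq_bigr => i _; ring.
Qed.

Lemma weighted_covC f g : weighted_cov f g = weighted_cov g f.
Proof. by rewrite /weighted_cov; congr weighted; apply/funext => x; rewrite mulrC. Qed.

(** Supplies the hypothesis of [process_linear]. By bilinearity the first term equals the third and
    the double sum equals the second. *)
Lemma weighted_cov_linear (I : finType) (a : I -> R) (e : I -> 'rV[R]_d -> R) f :
  (forall i, bounded_meas (e i)) -> bounded_meas f ->
  (forall x, f x = \sum_i a i * e i x) ->
  weighted_cov f f - \sum_i a i * weighted_cov f (e i)
    - \sum_i a i * weighted_cov (e i) f
    + \sum_i \sum_j a i * a j * weighted_cov (e i) (e j) = 0.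
Proof.
move=> be bf fE; rewrite {1}(weighted_cov_suml be bf fE).
rewrite (_ : \sum_i \sum_j _ = \sum_i a i * weighted_cov f (e i)); first by ring.
apply: eq_bigr => i _; rewrite weighted_covC.
rewrite weighted_covC (weighted_cov_suml be (be i) fE) mulr_sumr.
by apply: eq_bigr => j _; rewrite (weighted_covC (e i)) mulrA.
Qed.

Lemma weighted_cov_ge (g : 'rV[R]_d -> R) f : bounded_meas f ->
  (leb d).-integrable setT (EFin \o g) ->
  (forall x, g x <= (f x - weighted f) ^+ 2 * rho x) ->
  \int[leb d]_x g x <= weighted_cov f f.
Proof.
move=> bf gi gf; have bff := bounded_measM (bounded_measB (weighted f) bf)
  (bounded_measB (weighted f) bf).
rewrite /weighted_cov weightedE//; apply: le_Rintegral => //.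
  exact: integrable_weighted.
Qed.
End weighted.

Section variance.
Context {R : realType} {d : nat}.
Hypothesis d0 : (0 < d)%N.
Variables (phi : 'rV[R]_d -> R) (c delta : R).
Hypotheses (mphi : borel_fun phi) (c0 : 0 < c) (cphi : forall x, c <= phi x).
Hypothesis delta0 : 0 < delta.

Definition density (x : 'rV[R]_d) : R := phi x * japan (- d%:R - 2 * delta) x.

Hypothesis mass1 : intd (fun x => (density x)%:E) = 1%E.

Lemma enorm2 (x : 'rV[R]_d) : enorm x ^+ 2 = \sum_(i < d) x ord0 i ^+ 2.
Proof.
rewrite /enorm sqr_sqrtr; first by apply: eq_bigr => i _; rewrite expr2.
by apply: sumr_ge0 => i _; rewrite -expr2 sqr_ge0.
Qed.

Lemma density_ge0 x : 0 <= density x.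
Proof. by rewrite mulr_ge0 ?powR_ge0// (le_trans _ (cphi x))// ltW. Qed.

Lemma measurable_density : measurable_fun setT density.
Proof.
apply: measurable_funM; first exact/borel_funE.
apply: (measurableT_comp (measurable_powR _)); apply: measurable_funD => //.
under eq_fun do rewrite enorm2.
apply: measurable_sum => i; apply: measurable_funX; exact: measurable_coord.
Qed.

Lemma integrable_density : (leb d).-integrable setT (EFin \o density).
Proof.
have md : measurable_fun setT (EFin \o density) by apply/measurable_EFinP; exact: measurable_density.
apply/integrableP; split => //.
under eq_integral => x _ do rewrite /= ger0_norm ?density_ge0//.
rewrite -intdE//; first by rewrite mass1 ltry.
by move=> x; rewrite lee_fin density_ge0.
Qed.

(** Since [H >= 1], [1 + |x|^2 <= (1 + d * D^2) * H^2], and the exponent of [japan] is negative. The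
    scale [H] is kept apart from [D] so that the constant does not depend on it. *)
Lemma density_lower (H : R) (x : 'rV[R]_d) (D : R) : 1 <= H -> 0 < D ->
  (forall i, `|x ord0 i| <= D * H) ->
  c * ((1 + d%:R * D ^+ 2) `^ (- (d%:R + 2 * delta) / 2) * H `^ (- (d%:R + 2 * delta))) <=
  density x.
Proof.
move=> H1 D0 xD; have H0 : 0 < H by rewrite (lt_le_trans _ H1).
set g := d%:R + 2 * delta.
have g0 : 0 <= g by rewrite addr_ge0// mulr_ge0// ltW.
have nx : 1 + enorm x ^+ 2 <= (1 + d%:R * D ^+ 2) * H ^+ 2.
  rewrite mulrDl mul1r lerD ?exprn_ege1// enorm2.
  apply: (@le_trans _ _ (\sum_(i < d) (D * H) ^+ 2)).
    apply: ler_sum => i _; rewrite -real_normK ?num_real//.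
    by rewrite ler_sqr ?nnegrE ?mulr_ge0 ?(ltW D0) ?(ltW H0).
  by rewrite sumr_const card_ord exprMn -[leLHS]mulr_natl mulrA.
have x1 : 0 < 1 + enorm x ^+ 2 by rewrite ltr_pwDl// sqr_ge0.
have D1 : 0 < 1 + d%:R * D ^+ 2 by rewrite ltr_pwDl// mulr_ge0// sqr_ge0.
rewrite /density; apply: ler_pM; [exact: ltW|by rewrite mulr_ge0 ?powR_ge0|exact: cphi|].
rewrite /japan.
have -> : H `^ (- g) = (H ^+ 2) `^ (- g / 2).
  rewrite -powR_mulrn ?(ltW H0)// -powRrM; congr powR; by field.
rewrite -powRM ?(ltW D1) ?sqr_ge0//.
have -> : (- d%:R - 2 * delta) / 2 = - (g / 2) by rewrite /g; field.
rewrite mulNr !powRN lef_pV2 ?posrE ?powR_gt0// ?mulr_gt0 ?exprn_gt0//.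
have y0 : 0 <= (1 + d%:R * D ^+ 2) * H ^+ 2 by rewrite mulr_ge0 ?sqr_ge0 ?(ltW D1).
by apply: ge0_ler_powR; rewrite ?nnegrE ?divr_ge0 ?(ltW x1).
Qed.

(** The indicator of a cube, kept as a product so that [integral_prod_phase] yields its mass. *)
Definition box (z : 'rV[R]_d) (r : R) (x : 'rV[R]_d) : R :=
  \prod_(i < d) \1_(`[z ord0 i - r, z ord0 i + r]) (x ord0 i).

Lemma box_le (z : 'rV[R]_d) (r : R) (x : 'rV[R]_d) (v : R) : 0 <= v ->
  ((forall i : 'I_d, `|x ord0 i - z ord0 i| <= r) -> 1 <= v) -> box z r x <= v.
Proof.
move=> v0 h; have [/forallP xz|/forallPn[i xi]] :=
    boolP [forall i : 'I_d, `|x ord0 i - z ord0 i| <= r].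
  apply: le_trans (h xz); apply: prodr_ile1 => i _.
  by rewrite indicE; case: (_ \in _); rewrite ?lexx ?ler01.
rewrite /box (bigD1 i)//= indicE memNset ?mul0r//= in_itv /= => /andP[x1 x2].
by move: xi; rewrite ler_distl x1 x2.
Qed.

Lemma integrable_box z r : (leb d).-integrable setT (EFin \o box z r).
Proof.
apply: (@integrable_prod_coord _ _ (fun i t => \1_(`[z ord0 i - r, z ord0 i + r]) t)).
by move=> i; exact: integrable_indic_itv.
Qed.

Lemma Rintegral_box z r : 0 < r -> \int[leb d]_x box z r x = (2 * r) ^+ d.
Proof.
move=> r0.
pose u (i : 'I_d) t : R := \1_(`[z ord0 i - r, z ord0 i + r]) t.
have ui i : (@lebesgue_measure R).-integrable setT (EFin \o u i) by exact: integrable_indic_itv.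
have uE i th : \int[@lebesgue_measure R]_t (u i t * cos (th + 0 * t)) =
    cos (th + 0) * (2 * r).
  under eq_Rintegral do rewrite mul0r.
  rewrite RintegralZr// mulrC; congr (_ * _).
  rewrite /Rintegral integral_indic//= setIT lebesgue_measure_itv /= lte_fin ltrD2l gtrN//=.
  by rewrite /=; ring.
have := integral_prod_phase ui uE 0; rewrite big1// addr0 cos0 mul1r => E.
transitivity (\prod_(i < d) (2 * r)); last by rewrite prodr_const card_ord.
rewrite -E; apply: eq_Rintegral => x _; rewrite [X in cos (_ + X)]big1 ?addr0 ?cos0 ?mulr1// => i _.
by rewrite mul0r.
Qed.

Lemma bounded_meas_wave (L : R) z : bounded_meas (fun x : 'rV[R]_d => L * wave z x).
Proof.
split.
  apply: measurable_funM => //; apply: continuous_rv_measurable; exact: continuous_wave.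
exists (`|L| * ((bandwidth (R := R) (d := d)) ^+ 2) ^+ d) => x.
by rewrite normrM ler_wpM2l// ger0_norm ?wave_ge0 ?wave_le.
Qed.

Lemma wave_near (v : 'rV[R]_d) (eps : R) : 0 < eps -> exists2 r : R, 0 < r &
  forall y : 'rV[R]_d, (forall i, `|y ord0 i - v ord0 i| <= r) -> `|wave 0 y - wave 0 v| < eps.
Proof.
move=> e0; have /cvgrPdist_lt /(_ eps e0) := @continuous_wave R d 0 v.
move=> /nbhs_ballP[r /= r0 rB]; exists (r / 2); first by rewrite divr_gt0.
move=> y yv; rewrite distrC; apply: rB; split => // i j.
rewrite ord1 /ball /= distrC (le_lt_trans (yv j))//; lra.
Qed.

Lemma wave_zero : wave (0 : 'rV[R]_d) (const_mx d%:R) = 0.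
Proof.
have d1 : d%:R != 0 :> R by rewrite pnatr_eq0 -lt0n.
rewrite /wave (bigD1 (Ordinal d0))//= !mxE subr0 /sincsq (negbTE d1).
(* [bandwidth * d = pi] is a zero of the sine, and one vanishing factor is enough. *)
by rewrite /bandwidth divfK// sinpi mul0r expr0n mul0r.
Qed.

(* [wave z] takes both its maximum and the value 0 within a bounded distance of [z],
   so it stays away from any constant on a box of fixed size near [z]. *)
Lemma variance_lower (L : R) : 0 < L -> exists2 kappa : R, 0 < kappa &
  forall (z : 'rV[R]_d) (H : R), 1 <= H -> (forall i, 0 <= z ord0 i <= H) ->
  kappa * H `^ (- (d%:R + 2 * delta)) <=
  weighted_cov density (fun x => L * wave z x) (fun x => L * wave z x).
Proof.
move=> L0; pose top : R := (bandwidth (R := R) (d := d) ^+ 2) ^+ d.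
have top0 : 0 < top by rewrite !exprn_gt0// bandwidth_gt0.
have t4 : 0 < top / 4 by rewrite divr_gt0.
have [r1 r10 near1] := wave_near 0 t4.
have [r2 r20 near2] := wave_near (const_mx d%:R) t4.
rewrite wave_center in near1; rewrite wave_zero in near2.
pose r := Num.min r1 r2; have r0 : 0 < r by rewrite lt_min r10 r20.
(* Chosen for [H + d + r <= D * H] when [H >= 1]: points of the boxes used have coordinates at most
   [D * H] in modulus. *)
pose D : R := d%:R + r + 1.
have D0 : 0 < D by rewrite addr_gt0// addr_gt0// ltr0n.
set g := d%:R + 2 * delta.
pose k1 : R := (L * (top / 4)) ^+ 2 * (c * (1 + d%:R * D ^+ 2) `^ (- g / 2)).
have k10 : 0 < k1.
  have q0 : 0 < 1 + d%:R * D ^+ 2 by rewrite ltr_pwDl// mulr_ge0// sqr_ge0.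
  by rewrite /k1 mulr_gt0 ?exprn_gt0 ?(mulr_gt0 L0 t4)// mulr_gt0 ?powR_gt0.
exists (k1 * (2 * r) ^+ d); first by rewrite mulr_gt0// exprn_gt0// mulr_gt0.
move=> z H H1 zH; have H0 : 0 < H by rewrite (lt_le_trans _ H1).
set f := (fun x => _); pose m := weighted density f.
have bf : bounded_meas f by exact: bounded_meas_wave.
(* [v] is the offset of the box from [z]: 0 where the wave is maximal, [const_mx d%:R] where it
   vanishes. *)
have key (v : 'rV[R]_d) : (v = 0 \/ v = const_mx d%:R) ->
    (forall y : 'rV[R]_d, (forall i : 'I_d, `|y ord0 i - v ord0 i| <= r) ->
      (L * (top / 4)) ^+ 2 <= (L * wave 0 y - m) ^+ 2) ->
    k1 * (2 * r) ^+ d * H `^ (- g) <= weighted_cov density f f.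
  move=> vE hv.
  have vd i : 0 <= v ord0 i <= d%:R by case: vE => ->; rewrite mxE ?lexx ?ler0n.
  rewrite mulrAC -(Rintegral_box (z + v) r0).
  rewrite -RintegralZl//; last exact: integrable_box.
  apply: (weighted_cov_ge integrable_density bf).
    by apply: integrableZl_EFin; exact: integrable_box.
  move=> x; rewrite -ler_pdivlMl; last by rewrite mulr_gt0 ?powR_gt0.
  apply: box_le.
    apply: mulr_ge0; first by rewrite invr_ge0 mulr_ge0 ?powR_ge0 ?(ltW k10).
    by rewrite mulr_ge0 ?sqr_ge0 ?density_ge0.
  move=> xz; rewrite ler_pdivlMl ?mulr1; last by rewrite mulr_gt0 ?powR_gt0.
  rewrite /k1 -mulrA; apply: ler_pM.
  - exact: sqr_ge0.
  - by rewrite !mulr_ge0 ?powR_ge0 ?(ltW c0).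
  - rewrite /f -/m; have <- : wave 0 (x - z) = wave z x.
      by rewrite -[in RHS](add0r z) -[in RHS](subrK z x) wave_shift.
    by apply: hv => i; have := xz i; rewrite !mxE; congr (`|_| <= _); ring.
  rewrite -mulrA; apply: density_lower => // i.
  have := xz i; have /andP[z1 z2] := zH i; have /andP[v1 v2] := vd i.
  rewrite mxE ler_distl => /andP[x1 x2].
  have DH : H + d%:R + r <= D * H.
    have dr : 0 <= (d%:R + r) * (H - 1) by rewrite mulr_ge0 ?subr_ge0 ?addr_ge0 ?(ltW r0).
    by rewrite /D; nra.
  by rewrite ler_norml; apply/andP; split; lra.
(* The mean [m] lies on one side of half the maximum. Near the centre the scaled wave exceeds 3/4 of
   [L * top], near the zero it is below 1/4, so the gap to [m] is at least [L * (top / 4)] on one of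
   the boxes. *)
have [mt|mt] := leP m (L * (top / 2)).
  apply: (key 0); first by left.
  move=> y yr; have := near1 y.
  have yr1 i : `|y ord0 i - (0 : 'rV[R]_d) ord0 i| <= r1.
    by rewrite (le_trans (yr i))// ge_min lexx.
  move=> /(_ yr1); rewrite -/top ltr_distl => /andP[w1 _].
  rewrite ler_sqr ?nnegrE ?mulr_ge0 ?(ltW L0) ?(ltW t4)//; nra.
apply: (key (const_mx d%:R)); first by right.
move=> y yr; have := near2 y.
have yr2 i : `|y ord0 i - (const_mx d%:R : 'rV[R]_d) ord0 i| <= r2.
  by rewrite (le_trans (yr i))// ge_min lexx orbT.
move=> /(_ yr2); rewrite subr0 ltr_norml => /andP[_ w2].
rewrite -[leRHS]sqrrN opprB ler_sqr ?nnegrE ?mulr_ge0 ?(ltW L0) ?(ltW t4)//; nra.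
Qed.
End variance.

(** * Dyadic shells of lattice points *)

Section lattice_sums.
Context {R : realType}.
Implicit Types t u x b : R.

Definition sat u : R := u / (1 + `|u|).

Lemma sat_le1 u : `|sat u| <= 1.
Proof.
have u1 : 0 < 1 + `|u| by rewrite ltr_pwDl.
by rewrite /sat normrM normfV (gtr0_norm u1) ler_pdivrMr// mul1r lerDr.
Qed.

(* [sat] is a bounded primitive-like function, so sums of [1 / (1 + (t - n)^2)] telescope. *)
Lemma sat_step u : (1 + u ^+ 2)^-1 <= 4 * (sat (u + 1) - sat u).
Proof.
have aux (x n D : R) : 0 < x -> 0 < D -> D <= 4 * n * x -> x^-1 <= 4 * (n / D).
  by move=> x0 D0 h; rewrite mulrA ler_pdivlMr// mulrC ler_pdivrMr.
have u2 : 0 < 1 + u ^+ 2 by rewrite ltr_pwDl// sqr_ge0.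
rewrite /sat; have [u0|u0] := leP 0 u.
  have u1 : 0 <= u + 1 by rewrite addr_ge0.
  rewrite !ger0_norm//.
  have -> : (u + 1) / (1 + (u + 1)) - u / (1 + u) = 1 / ((u + 1) * (u + 2)).
    by field; rewrite !gt_eqF//; lra.
  by apply: aux => //; nra.
rewrite (ltr0_norm u0); have [u1|u1] := leP 0 (u + 1).
  rewrite ger0_norm//.
  have -> : (u + 1) / (1 + (u + 1)) - u / (1 - u) =
      (1 - 2 * u - 2 * u ^+ 2) / ((u + 2) * (1 - u)).
    by field; rewrite !gt_eqF//; lra.
  by apply: aux => //; nra.
rewrite ltr0_norm//.
have -> : (u + 1) / (1 - (u + 1)) - u / (1 - u) = 1 / (u * (u - 1)).
  by field; do ?(apply/andP; split); apply/negP => /eqP ?; lra.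
by apply: aux => //; nra.
Qed.

Lemma lattice_sum_le b t n0 N :
  \sum_(j < N) sincsq b (t - (n0 + j)%:R) <=
  4 * (1 + b ^+ 2) * (sat (t - n0%:R + 1) - sat (t - (n0 + N)%:R + 1)).
Proof.
elim: N => [|N IHN]; first by rewrite big_ord0 addn0 subrr mulr0.
rewrite big_ord_recr /=.
have := sincsq_decay b (t - (n0 + N)%:R); rewrite ger0_norm ?sincsq_ge0// => sN.
have := sat_step (t - (n0 + N)%:R); rewrite -(ler_pM2l (_ : 0 < 1 + b ^+ 2)); last first.
  by rewrite ltr_pwDl// sqr_ge0.
have -> : t - (n0 + N.+1)%:R + 1 = t - (n0 + N)%:R by rewrite addnS -natr1; ring.
lra.
Qed.

Definition shell b m t : R := \sum_(j < 2 ^ m) sincsq b (t - (2 ^ m + j)%:R).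

Lemma shell_ge0 b m t : 0 <= shell b m t.
Proof. by apply: sumr_ge0 => j _; exact: sincsq_ge0. Qed.

(** The blocks from [2^m] to [2^(m+1) - 1] are adjacent, so their telescoping bounds concatenate
    into one that is uniform in [M]. *)
Lemma sum_shell_le b t M : \sum_(m < M) shell b m t <= 8 * (1 + b ^+ 2).
Proof.
have b0 : 0 < 1 + b ^+ 2 by rewrite ltr_pwDl// sqr_ge0.
have tele : \sum_(m < M) shell b m t <=
    4 * (1 + b ^+ 2) * (sat (t - 1 + 1) - sat (t - (2 ^ M)%:R + 1)).
  elim: M => [|M IHM]; first by rewrite big_ord0 expn0 subrr mulr0.
  rewrite big_ord_recr /=; have := lattice_sum_le b t (2 ^ M) (2 ^ M).
  rewrite addnn -mul2n -expnS -/(shell b M t); lra.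
apply: (le_trans tele).
have := sat_le1 (t - 1 + 1); have := sat_le1 (t - (2 ^ M)%:R + 1).
by rewrite !ler_norml => /andP[? _] /andP[_ ?]; nra.
Qed.

Lemma shell_le b m t : shell b m t <= 8 * (1 + b ^+ 2).
Proof.
apply: le_trans (sum_shell_le b t m.+1); rewrite big_ord_recr /= lerDr.
by apply: sumr_ge0 => i _; exact: shell_ge0.
Qed.
End lattice_sums.

Section dyadic.
Context {R : realType} {d : nat}.
Hypothesis d0 : (0 < d)%N.
Local Notation b := (bandwidth (R := R) (d := d)).

(** All shells share the offset range [2 ^ M], which gives a plain product type instead of one where
    the range depends on the shell. *)
Definition dyadic (M : nat) : finType := ('I_M * {ffun 'I_d -> 'I_(2 ^ M)})%type.

Definition in_shell M (p : dyadic M) : bool := [forall i, (p.2 i < 2 ^ p.1)%N].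

Definition site M (p : dyadic M) : 'rV[R]_d := \row_i (2 ^ p.1 + p.2 i)%:R.

(** Distributivity of products over sums. It is applied with [sincsq] factors for the overlap bound
    and with factors 1 for counting sites. *)
Lemma sum_dyadic M (h : 'I_M -> R) (F : 'I_d -> 'I_M -> nat -> R) :
  \sum_(p : dyadic M | in_shell p) h p.1 * \prod_i F i p.1 (p.2 i) =
  \sum_(m < M) h m * \prod_i \sum_(j < 2 ^ m) F i m j.
Proof.
rewrite -(pair_big_dep xpredT (fun (m : 'I_M) (k : {ffun 'I_d -> 'I_(2 ^ M)}) =>
  [forall i, (k i < 2 ^ m)%N]) (fun m k => h m * \prod_i F i m (k i))) /=.
apply: eq_bigr => m _; rewrite -mulr_sumr; congr (_ * _).
have mM : (2 ^ m <= 2 ^ M)%N by rewrite leq_exp2l// ltnW.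
under [RHS]eq_bigr do rewrite (big_ord_widen _ _ mM).
rewrite bigA_distr_big_dep; apply: eq_bigl => k.
by apply/forallP/familyP.
Qed.

(** A single coordinate absorbs the sum over all shells through [sum_shell_le]; the other [d - 1]
    factors are bounded shell by shell. Hence no dependence on [M]. *)
Lemma sum_wave_site_le M x :
  \sum_(p : dyadic M | in_shell p) wave (site p) x <= (8 * (1 + b ^+ 2)) ^+ d.
Proof.
pose F (i : 'I_d) (m : 'I_M) (j : nat) := sincsq b (x ord0 i - (2 ^ m + j)%:R).
rewrite (eq_bigr (fun p : dyadic M => 1 * \prod_i F i p.1 (p.2 i))); last first.
  by move=> p _; rewrite mul1r; apply: eq_bigr => i _; rewrite /F /site mxE.
rewrite (sum_dyadic (fun=> 1)).
pose i0 := Ordinal d0; pose B : R := 8 * (1 + b ^+ 2).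
have B0 : 0 <= B by rewrite mulr_ge0// addr_ge0// sqr_ge0.
apply: (@le_trans _ _ (\sum_(m < M) shell b m (x ord0 i0) * B ^+ d.-1)).
  apply: ler_sum => m _; rewrite mul1r (bigD1 i0)//= ler_wpM2l//; first exact: shell_ge0.
  apply: (@le_trans _ _ (\prod_(i < d | i != i0) B)).
    apply: ler_prod => i _; rewrite (shell_le b m (x ord0 i)) andbT.
    exact: (shell_ge0 b m (x ord0 i)).
  by rewrite prodr_const cardC1 card_ord.
rewrite -mulr_suml -/B; have -> : B ^+ d = B * B ^+ d.-1 by rewrite -exprS prednK.
by rewrite ler_wpM2r ?exprn_ge0// sum_shell_le.
Qed.

Lemma count_shell M (h : 'I_M -> R) :
  \sum_(p : dyadic M | in_shell p) h p.1 = \sum_(m < M) (2 ^+ m) ^+ d * h m.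
Proof.
have := sum_dyadic h (fun _ _ _ => 1).
rewrite (eq_bigr (fun p => h p.1)) => [->|p _]; last by rewrite prodr_const expr1n mulr1.
apply: eq_bigr => m _; rewrite mulrC (eq_bigr (fun=> 2 ^+ m)) => [|i _].
  by rewrite prodr_const card_ord.
by rewrite sumr_const card_ord natrX.
Qed.

Variable ip : R.
Hypothesis ip01 : 0 <= ip < 1 / 2.

(* [in_shell p] says that [site p] lies in the [p.1]-th shell [2^m, 2^(m+1))^d; all other
   indices are junk and get coefficient 0. With [ip = 1/p] the [p]-th powers sum to 1. *)
Definition coeff M (p : dyadic M) : R :=
  if in_shell p then (2 ^+ p.1) `^ (- (d%:R * ip)) * M%:R `^ (- ip) else 0.

Lemma coeff_ge0 M p : 0 <= @coeff M p.
Proof. by rewrite /coeff; case: ifP => // _; rewrite mulr_ge0 ?powR_ge0. Qed.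

Lemma coeff_le1 M p : @coeff M p <= 1.
Proof.
have [ip0 _] := andP ip01.
have le1 (x y : R) : 1 <= x -> 0 <= y -> x `^ (- y) <= 1.
  by move=> x1 y0; rewrite -(powRr0 x) ler_powR// oppr_le0.
rewrite /coeff; case: ifP => // _; rewrite mulr_ile1 ?powR_ge0 ?le1 ?mulr_ge0//.
  by rewrite exprn_ege1// ler1n.
by case: p => m k; rewrite ler1n (leq_ltn_trans _ (ltn_ord m)).
Qed.

(** A shell has [2^(m d)] sites, each contributing [2^(-m d) / M], hence total [1 / M]; for [M = 0]
    the sum is empty. *)
Lemma sum_coeff_powR M r : ip = r^-1 -> 0 < r -> \sum_p (@coeff M p) `^ r <= 1.
Proof.
move=> ipr r0; rewrite (bigID (@in_shell M)) /= [X in _ + X]big1 ?addr0; last first.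
  by move=> p /negbTE np; rewrite /coeff np powR0// gt_eqF.
pose h (m : 'I_M) : R := ((2 ^+ m) `^ (- (d%:R * ip)) * M%:R `^ (- ip)) `^ r.
rewrite (eq_bigr (fun p : dyadic M => h p.1)); last by move=> p sp; rewrite /coeff sp.
rewrite count_shell (eq_bigr (fun=> (M%:R^-1 : R))).
  rewrite sumr_const card_ord -[leLHS]mulr_natr; case: M {h} => [|M].
    by rewrite mulr0.
  by rewrite mulVf// pnatr_eq0.
move=> m _; rewrite /h powRM ?powR_ge0// -!powRrM ipr.
have -> : - (d%:R * r^-1) * r = - d%:R by rewrite mulNr -mulrA mulVf ?mulr1// gt_eqF.
have -> : - r^-1 * r = - 1 by rewrite mulNr mulVf// gt_eqF.
rewrite !powRN powRr1// powR_mulrn ?exprn_ge0// mulrA mulfV ?mul1r//.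
Qed.

(** In each shell the number of sites, the coefficient and the lower bound on the deviation multiply
    to [c * M^(- ip)], all powers of [2^m] cancelling; the [M] shells together give
    [c * M^(1 - ip)]. *)
Lemma sum_coeff_large (kappa g : R) (v : forall M, dyadic M -> R) :
  0 < kappa -> g / 2 <= d%:R - d%:R * ip ->
  (forall M p, in_shell p -> kappa * (2 ^+ p.1.+1) `^ (- g) <= v M p) ->
  forall C : R, exists M, C < \sum_p @coeff M p * Num.sqrt (v M p).
Proof.
move=> k0 gip vk C; have [ip0 ip2] := andP ip01.
set e := d%:R - d%:R * ip in gip.
(* The factor [2^(- e)] pays for the outer side [2^(m+1)] of a shell standing in for [2^m]. *)
pose c : R := Num.sqrt kappa * 2 `^ (- e).
have c0 : 0 < c by rewrite mulr_gt0 ?sqrtr_gt0 ?powR_gt0.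
(* [M] is a square: as [ip < 1/2], [M^(1 - ip) >= M^(1/2) = n]. *)
pose n := (Num.trunc (`|C| / c)).+1; pose M := (n ^ 2)%N.
have nC : C < c * n%:R.
  rewrite mulrC -ltr_pdivrMr//; apply: (@le_lt_trans _ _ (`|C| / c)).
    by rewrite ler_pM2r ?invr_gt0// ler_norm.
  by rewrite /n real_truncnS_gt ?num_real.
have M0 : 0 < M%:R :> R by rewrite ltr0n expn_gt0.
exists M; apply: (lt_le_trans nC).
rewrite (bigID (@in_shell M)) /= ler_wpDr//.
  by apply: sumr_ge0 => p _; rewrite mulr_ge0 ?coeff_ge0 ?sqrtr_ge0.
pose h (m : 'I_M) : R := ((2 ^+ m) `^ (- (d%:R * ip)) * M%:R `^ (- ip)) *
  (Num.sqrt kappa * (2 ^+ m.+1) `^ (- e)).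
apply: (@le_trans _ _ (\sum_(p : dyadic M | in_shell p) h p.1)); last first.
  apply: ler_sum => p sp; rewrite /coeff sp /h ler_wpM2l ?mulr_ge0 ?powR_ge0//.
  apply: (@le_trans _ _ (Num.sqrt (kappa * (2 ^+ p.1.+1) `^ (- g)))); last first.
    by rewrite ler_sqrt ?vk// (le_trans _ (vk M p sp))// mulr_ge0 ?powR_ge0// ltW.
  rewrite sqrtrM ?(ltW k0)// ler_wpM2l ?sqrtr_ge0//.
  have -> : (2 ^+ p.1.+1 : R) `^ (- g) = ((2 ^+ p.1.+1) `^ (- g / 2)) ^+ 2.
    by rewrite -[RHS]powR_mulrn ?powR_ge0// -powRrM; congr powR; field.
  rewrite sqrtr_sqr ger0_norm ?powR_ge0// ler_powR//; first by rewrite exprn_ege1// ler1n.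
  by rewrite mulNr lerN2.
have hE (m : 'I_M) : (2 ^+ m) ^+ d * h m = c * M%:R `^ (- ip).
  have m0 : 0 < 2 ^+ m :> R by rewrite exprn_gt0.
  rewrite /h exprS powRM ?(ltW m0)// -(@powR_mulrn _ (2 ^+ m) d) ?(ltW m0)//.
  have E : (2 ^+ m : R) `^ d%:R * (2 ^+ m) `^ (- (d%:R * ip)) * (2 ^+ m) `^ (- e) = 1.
    rewrite -!powRD ?(gt_eqF m0) ?implybT//.
    by rewrite (_ : _ + _ + _ = 0) ?powRr0// /e; ring.
  transitivity ((2 ^+ m : R) `^ d%:R * (2 ^+ m) `^ (- (d%:R * ip)) * (2 ^+ m) `^ (- e) *
    (c * M%:R `^ (- ip))); first by rewrite /c; ring.
  by rewrite E mul1r.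
rewrite count_shell (eq_bigr _ (fun m _ => hE m)) sumr_const card_ord -[leRHS]mulr_natr.
rewrite -mulrA ler_wpM2l ?(ltW c0)//.
have -> : M%:R `^ (- ip) * M%:R = M%:R `^ (1 - ip) :> R.
  by rewrite -[X in _ * X](powRr1 (ltW M0)) -powRD ?(gt_eqF M0) ?implybT// addrC.
have -> : n%:R = M%:R `^ (1 / 2) :> R.
  rewrite /M natrX -powR_mulrn// -powRrM (_ : 2%:R * (1 / 2) = 1) ?powRr1//.
  by field.
rewrite ler_powR//; first by rewrite ler1n expn_gt0.
lra.
Qed.
End dyadic.

(** * Contradiction with bounded sample paths *)

Theorem theorem4 (R : realType) (d : nat) (p q : \bar R) (s : R)
    (phi0 : 'rV[R]_d -> R) (delta : R) (phi : 'rV[R]_d -> R) (c : R) :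
  (2%:E < p)%E -> (1%:E <= q)%E -> d%:R / 2 < s ->
  besov_cutoff phi0 ->
  0 < delta -> delta <= d%:R / 2 - d%:R * inv_ext p ->
  borel_fun phi -> 0 < c -> (forall x, c <= phi x) ->
  intd (fun x => (phi x * japan (- d%:R - 2 * delta) x)%:E) = 1%E ->
  ~ pregaussian (fun h => integ (fun x => h x * (phi x * japan (- d%:R - 2 * delta) x)))
                (besov_unit_ball phi0 s p q).
Proof.
move=> p2 q1 _ cut delta0 deltap mphi c0 cphi mass1.
move=> [d' [T [Pr [G [mG [law bG]]]]]].
(* In dimension 0 the two bounds on [delta] contradict each other. *)
have d0 : (0 < d)%N.
  by rewrite lt0n; apply: contraTneq deltap => ->; rewrite !mul0r subr0 -ltNge.
have ip01 : 0 <= inv_ext p < 1 / 2.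
  case: p p2 {law bG mG deltap} => [r||]//=; last by move=> _; lra.
  rewrite lte_fin => r2; have r0 : 0 < r by rewrite (lt_trans _ r2).
  by rewrite invr_ge0 (ltW r0) /= mul1r ltf_pV2 ?posrE.
pose b : R := bandwidth (R := R) (d := d).
(* The first summand bounds the overlap of the sites, the second a single wave anywhere, so that one
   scale [L] normalises both the waves [e z] and their combinations. *)
pose B : R := (8 * (1 + b ^+ 2)) ^+ d + (b ^+ 2) ^+ d.
have bb : 0 < b ^+ 2 by rewrite exprn_gt0// bandwidth_gt0.
have b1 : 0 < 8 * (1 + b ^+ 2) by rewrite mulr_gt0// addr_gt0.
have B0 : 0 < B by rewrite addr_gt0// exprn_gt0.
pose L := ball_scale (d := d) B.
have L0 : 0 < L by exact: ball_scale_gt0.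
pose e (z : 'rV[R]_d) x := L^-1 * wave z x.
pose F := besov_unit_ball phi0 s p q.
have Fe z : F (e z).
  have -> : e z = waves (fun _ : unit => L^-1 * 1) (fun=> z).
    by apply/funext => x; rewrite /waves big_const card_unit /= addr0 mulr1.
  apply: waves_in_ball => //.
  - move=> x; rewrite (eq_bigl xpredT); last by move=> u; rewrite oner_eq0.
    rewrite big_const card_unit /= addr0 (le_trans (wave_le z x))//.
    by rewrite lerDr exprn_ge0// mulr_ge0// addr_ge0// ltW.
  - by move=> _; rewrite normr1.
  - by move=> r _; rewrite big_const card_unit /= addr0 normr1 powR1.
pose cf M (sg : {ffun @dyadic d M -> bool}) (j : @dyadic d M) : R :=
  (-1) ^+ sg j * coeff (inv_ext p) j.
pose comb M sg := waves (fun j => L^-1 * cf M sg j) (@site R d M).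
have ncf M sg j : `|cf M sg j| = coeff (inv_ext p) j.
  by rewrite normrM normrX normrN1 expr1n mul1r ger0_norm ?coeff_ge0.
have Fcomb M sg : F (comb M sg).
  apply: waves_in_ball => //.
  - move=> x; apply: (@le_trans _ _ ((8 * (1 + b ^+ 2)) ^+ d)).
      apply: le_trans (sum_wave_site_le d0 M x).
      (* Indices with nonzero coefficient satisfy [in_shell], and waves are nonnegative, so the sum
         may be enlarged to all sites. *)
      rewrite big_mkcond [leRHS]big_mkcond /=; apply: ler_sum => j _.
      case: ifPn => [cj|_]; last by case: ifP => // _; exact: wave_ge0.
      rewrite ifT//; apply: contraNT cj => /negbTE nj.
      by rewrite -normr_eq0 ncf /coeff nj.
    by rewrite lerDl exprn_ge0// ltW.
  - by move=> j; rewrite ncf; exact: coeff_le1.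
  - move=> r pr; under eq_bigr do rewrite ncf.
    apply: sum_coeff_powR => //; first by rewrite pr.
    by move: p2; rewrite pr lte_fin; apply: lt_trans.
have bF f : F f -> bounded_meas f.
  by move=> [cf' [Mf _]]; split => //; exact: continuous_rv_measurable.
pose cov := weighted_cov (density phi delta).
have rhoi := integrable_density mphi c0 cphi mass1.
(* The covariance inside [pregaussian] unfolds to [cov], hence the conversion by [exact]. *)
have lawF : forall (n : nat) (fs : 'I_n -> 'rV[R]_d -> R) (a : 'I_n -> R),
  (forall i, F (fs i)) -> forall A : set R, measurable A ->
  Pr ((fun w => \sum_(i < n) a i * G (fs i) w) @^-1` A) =
  gauss_law (\sum_(i < n) \sum_(j < n) a i * a j * cov (fs i) (fs j)) A by exact: law.
have cov0 z : 0 <= cov (e z) (e z).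
  have := @weighted_cov_ge _ _ _ rhoi (fun=> 0) (e z) (bF _ (Fe z)).
  rewrite /Rintegral integral0 /=; apply; first exact: integrable0.
  by move=> x; rewrite mulr_ge0 ?sqr_ge0//; exact: density_ge0 c0 cphi _.
have Li : 0 < L^-1 by rewrite invr_gt0.
have [kappa k0 kl] := variance_lower d0 mphi c0 cphi delta0 mass1 Li.
apply: (@process_unbounded _ _ _ Pr _ F G cov mG lawF (fun M => @dyadic d M)
  (fun M j => e (site j)) (fun M j => coeff (inv_ext p) j) comb).
- by move=> w; have [] := bG w.
- by move=> M j; exact: Fe.
- by move=> M j; exact: cov0.
- by move=> M j; exact: coeff_ge0.
- exact: Fcomb.
- move=> M sg; apply: (process_linear mG lawF (a := cf M sg) (e := fun j => e (site j))).
  + exact: Fcomb.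
  + by move=> j; exact: Fe.
  + apply: weighted_cov_linear => //.
    * by move=> j; exact/bF/Fe.
    * exact/bF/Fcomb.
    * by move=> x; apply: eq_bigr => j _; rewrite /e; ring.
- have gip : (d%:R + 2 * delta) / 2 <= d%:R - d%:R * inv_ext p by lra.
  apply: (sum_coeff_large ip01 k0 gip) => M j sj; apply: kl.
    by rewrite exprn_ege1// ler1n.
  (* Coordinates [2^m + j] with [j < 2^m] are at most [H = 2^(m+1)]. *)
  move=> i; rewrite mxE ler0n /= -natrX ler_nat expnS mul2n -addnn leq_add2l ltnW//.
  by move/forallP : sj; exact.
Qed.
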